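(* Let $n\ge 3$, let $\Omega \subset \mathbb{R}^n$ be an open subset with diameter $R$, fix $k \in \{1,\ldots, n-1\}$ and let $E \Subset \Omega$ be a compact subset satisfying $\mathscr{H}_\Psi(E) < \infty$, where \[ \Psi(t) = \begin{cases} Rt & \text{if } k=1, \\ t^2 |\log(R/t)| & \text{if } k=2, \\ t^2 & \text{if } k \ge 3. \end{cases} \] Fix $h \in [0,\infty)$ satisfying $hR < k$. Then there exists a constant $C_1= C_1(n,k,hR)$ with the following property: for each $Q \in (\mathscr{H}_\Psi(E), \infty)$ there exist a relatively compact open set $U$ containing $E$ and a function $w \in C^2(\overline\Omega)$ such that $w < 0$ on $\overline{\Omega}$ and \[ \mathscr{F}_k^-[w] \ge \mathbb{1}_{U} \ \text{ on } \Omega, \qquad \|w\|_\infty \le C_1 Q. \] In particular, \[ \mathscr{F}_k^-[w] + \frac{1}{C_1 Q} w \ge 0 \ \text{ on } U, \qquad \mathscr{F}_k^-[w] \ge 0 \ \text{ on } \Omega, \] and \[ \bar{\mu}(\mathscr{F}_k^-,E) \ge \frac{1}{C_1\mathscr{H}_\Psi(E)}. \]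
   Context: For a symmetric matrix $A$ with eigenvalues $\lambda_1(A)\le\dots\le\lambda_n(A)$, $\mathcal{P}_k^-(A)=\lambda_1(A)+\dots+\lambda_k(A)$, and $\mathscr{F}_k^-[w] = \mathcal{P}_k^-(\nabla^2 w) - h|\nabla w|$. $\mathbb{1}_U$ is the indicator function of $U$. For an open set $V\subset\mathbb{R}^n$, $\bar\mu(\mathscr{F}_k^-,V) = \sup\{c\in\mathbb{R} : \exists\, w \in \mathrm{USC}(\overline V),\ w<0 \text{ on } \overline V,\ \mathscr{F}_k^-[w]+cw\ge 0 \text{ in the viscosity sense on } V\}$, and for a set $E$, $\bar\mu(\mathscr{F}_k^-,E)=\sup\{\bar\mu(\mathscr{F}_k^-,V): V \text{ open}, E\subset V\}$. Generalized Hausdorff measure: $\mathscr{H}_\Psi(E) = \lim_{\delta\to 0^+}\inf\{\sum_j \Psi(r_j) : E\subset \bigcup_{j} B_{r_j}(x_j),\ r_j\le\delta\}$; the convention $1/0=+\infty$ is used. *)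

(* Defs.v *)
From HB Require Import structures.
From mathcomp Require Import all_boot all_order all_algebra.
From mathcomp Require Import all_classical all_reals all_analysis.
Set Implicit Arguments. Unset Strict Implicit. Unset Printing Implicit Defensive.
Import Order.TTheory GRing.Theory Num.Theory.
Import numFieldNormedType.Exports.
Local Open Scope classical_set_scope.
Local Open Scope ring_scope.

Section Defs.
Variables (R : realType) (n : nat).
Notation V := ('rV[R]_n).

Definition enorm (v : V) : R := Num.sqrt (\sum_(i < n) v ord0 i ^+ 2).

Definition eball (x : V) (r : R) : set V := [set y | enorm (y - x) < r].

(* diameter of a set (sup of Euclidean distances; -oo for the empty set) *)
Definition diam (A : set V) : \bar R :=
  ereal_sup [set z | exists x y, A x /\ A y /\ z = (enorm (x - y))%:E].

Definition evec (i : 'I_n) : V := delta_mx ord0 i.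
Definition pd (i : 'I_n) (f : V -> R) : V -> R := fun x => 'D_(evec i) f x.

Definition C2_on (O : set V) (f : V -> R) : Prop :=
  forall x, O x ->
    [/\ {for x, continuous f},
        forall i, derivable f x (evec i) /\ {for x, continuous (pd i f)} &
        forall i j, derivable (pd i f) x (evec j) /\
                    {for x, continuous (pd j (pd i f))}].

Definition extends_cont (O : set V) (g : V -> R) : Prop :=
  exists G : V -> R, {within closure O, continuous G} /\ forall x, O x -> G x = g x.

Definition C2_closure (O : set V) (w : V -> R) : Prop :=
  [/\ C2_on O w, {within closure O, continuous w},
      forall i, extends_cont O (pd i w) &
      forall i j, extends_cont O (pd j (pd i w))].

Definition hessian (w : V -> R) (x : V) : 'M[R]_n :=
  \matrix_(i, j) pd j (pd i w) x.

Definition gradnorm (w : V -> R) (x : V) : R :=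
  Num.sqrt (\sum_(i < n) (pd i w x) ^+ 2).

Definition is_eigseq (A : 'M[R]_n) (s : seq R) : Prop :=
  sorted <=%R s /\ char_poly A = \prod_(x <- s) ('X - x%:P).

Definition eigseq (A : 'M[R]_n) : seq R := xget [::] (is_eigseq A).

Definition Pkminus (k : nat) (A : 'M[R]_n) : R :=
  \sum_(i < k) nth 0 (eigseq A) i.

Definition Fk (h : R) (k : nat) (w : V -> R) (x : V) : R :=
  Pkminus k (hessian w x) - h * gradnorm w x.

Definition usc_on (A : set V) (w : V -> R) : Prop :=
  forall x, A x -> forall e : R, 0 < e ->
    \forall y \near x, A y -> w y < w x + e.

Definition visc_super (h : R) (k : nat) (c : R) (O : set V) (w : V -> R) : Prop :=
  forall x0, O x0 -> forall phi : V -> R,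
    (exists N : set V, [/\ open N, N x0 & C2_on N phi]) ->
    (\forall y \near x0, w y - phi y <= w x0 - phi x0) ->
    0 <= Fk h k phi x0 + c * w x0.

Definition mubar_open (h : R) (k : nat) (O : set V) : \bar R :=
  ereal_sup [set (c%:E)%E | c in
    [set c : R | exists w : V -> R,
       [/\ usc_on (closure O) w, (forall x, closure O x -> w x < 0) &
           visc_super h k c O w]]].

Definition mubar (h : R) (k : nat) (E : set V) : \bar R :=
  ereal_sup [set mubar_open h k O | O in [set O : set V | open O /\ E `<=` O]].

Definition Psi (k : nat) (Rd : R) (t : R) : R :=
  if k == 1%N then Rd * t
  else if k == 2%N then t ^+ 2 * `|ln (Rd / t)|
  else t ^+ 2.

Definition Hdelta (Ps : R -> R) (E : set V) (d : R) : \bar R :=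
  ereal_inf [set S | exists (c : nat -> V) (r : nat -> R),
     [/\ (forall j, 0 <= r j <= d),
         E `<=` \bigcup_j eball (c j) (r j) &
         S = (\sum_(0 <= j <oo) (Ps (r j))%:E)%E]].

Definition HPsi (Ps : R -> R) (E : set V) : \bar R :=
  lim (Hdelta Ps E d @[d --> 0^'+]).

End Defs.

(* Main.v *)
Require Import Defs.
From HB Require Import structures.
From mathcomp Require Import all_boot all_order all_algebra.
From mathcomp Require Import complex.
From mathcomp Require Import all_classical all_reals all_analysis.
From mathcomp Require Import ring lra.
Import Order.TTheory GRing.Theory Num.Theory.
Import numFieldNormedType.Exports.
Local Open Scope classical_set_scope.
Local Open Scope ring_scope.

(** [E] is covered by finitely many balls [B_r(c)] meeting [E], with
    [sum Psi r <= Q], and [w] is the constant [- Q] plus a sum of radial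
    functions [phi (|x - c|^2)], one per ball.  Put [t = sqrt (|x - c|^2 + r^2)]
    and [m = min k 3].  The derivative of [phi] is a multiple of
    [(r / t)^m exp (h t)], a regularisation of [f' / rho] for the radial
    solution of [f'' + (k - 1) f' / rho = h f'] (for [k > 3] the smaller exponent is still
    a subsolution and already integrates to [r^2]).  With [rho = |x - c| <= R]
    and [h R = a < k], the operator applied to one summand is bounded below by
    a positive multiple of [(k - a) (r / t)^2 phi'], while
    integrating [phi'] up to [R^2] gives [|phi| <= C Psi r].

    Concavity of the sum of the [k] lowest eigenvalues is replaced by evaluating
    the quadratic form of the Hessian on one fixed finite family [us] of vectors
    with [sum |u|^2 = k] and [sum (u . x)^2 <= |x|^2], which realises
    [Pkminus] of the Hessian at hand; the value is additive in the Hessian, and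
    the bound for each summand holds for every such family.  The same
    device shows that [w] is a viscosity subsolution: at a touching point one
    uses a family realising [Pkminus] for the Hessian of the test function. *)

Set Implicit Arguments. Unset Strict Implicit. Unset Printing Implicit Defensive.

(** * Spectral families *)

Lemma char_poly_conj (F : fieldType) n (P D : 'M[F]_n) :
  P \in unitmx -> char_poly (invmx P *m D *m P) = char_poly D.
Proof.
move=> Pu.
have cE : char_poly_mx (invmx P *m D *m P) =
    map_mx polyC (invmx P) *m char_poly_mx D *m map_mx polyC P.
  rewrite /char_poly_mx mulmxBr mulmxBl !map_mxM /=; congr (_ - _).
  rewrite scalar_mxC -mulmxA -map_mxM mulVmx // map_mx1 mulmx1 //.
rewrite /char_poly cE !det_mulmx mulrC mulrA -det_mulmx -map_mxM mulmxV //.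
by rewrite map_mx1 det1 mul1r.
Qed.

Section RealSpectral.
Variables (R : realType) (n : nat).

(** [U] and [V] are the real and imaginary parts of a unitary matrix [P] diagonalising [A] over the
    complex numbers. Since [A] and its spectrum are real, [P A = D P] splits into the two
    intertwining relations; the other two matrix identities are the real parts of [P P* = 1] and
    [P* P = 1]. *)
Lemma real_sym_spectral (A : 'M[R]_n) : A^T = A ->
  exists (U V : 'M[R]_n) (d : 'rV[R]_n),
    [/\ U *m A = diag_mx d *m U, V *m A = diag_mx d *m V,
        U *m U^T + V *m V^T = 1%:M, U^T *m U + V^T *m V = 1%:M &
        char_poly A = \prod_(i < n) ('X - (d ord0 i)%:P)].
Proof.
move=> Asym.
pose Re := @complex.Re R. pose Im := @complex.Im R.
have Re_sum (I : Type) (r : seq I) (F : I -> R[i]%C) :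
    Re (\sum_(i <- r) F i) = \sum_(i <- r) Re (F i).
  by apply: (big_morph Re) => // -[? ?] [? ?].
have Im_sum (I : Type) (r : seq I) (F : I -> R[i]%C) :
    Im (\sum_(i <- r) F i) = \sum_(i <- r) Im (F i).
  by apply: (big_morph Im) => // -[? ?] [? ?].
pose AC : 'M[R[i]%C]_n := map_mx (real_complex R) A.
have ACsym : AC \is symmetricmx.
  apply/is_hermitianmxP; rewrite expr0 scale1r map_mx_id //.
  by apply/matrixP => i j; rewrite !mxE -{1}Asym mxE.
have ACreal : AC \is a realmx.
  by apply/mxOverP => i j; rewrite mxE; apply/complex_realP; exists (A i j).
have herm := realsym_hermsym ACsym ACreal.
have /orthomx_spectralP := hermitian_normalmx herm.
have := hermitian_spectral_diag_real herm.
have := spectral_unitarymx AC.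
set P := spectralmx AC; set D := spectral_diag AC => Pun Dreal AE.
have Pu := unitarymx_unit Pun.
pose U := map_mx Re P; pose V := map_mx Im P; pose d := map_mx Re D.
have DE i : D ord0 i = (d ord0 i)%:C%C.
  rewrite mxE RRe_real //; exact/mxOverP.
have PA : P *m AC = diag_mx D *m P by rewrite {1}AE -mulmxA mulKVmx.
exists U, V, d; split.
- apply/matrixP => i j; rewrite mul_diag_mx !mxE.
  have /matrixP/(_ i j) := PA; rewrite mul_diag_mx !mxE DE => /(congr1 Re).
  rewrite Re_sum /= => h.
  transitivity (Re ((d ord0 i)%:C%C * P i j)); last first.
    by rewrite !mxE /=; case: (P i j) => x y /=; rewrite mul0r subr0.
  rewrite -h; apply: eq_bigr => k _; rewrite !mxE /=.
  by case: (P i k) => x y /=; rewrite mulr0 subr0.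
- apply/matrixP => i j; rewrite mul_diag_mx !mxE.
  have /matrixP/(_ i j) := PA; rewrite mul_diag_mx !mxE DE => /(congr1 Im).
  rewrite Im_sum /= => h.
  transitivity (Im ((d ord0 i)%:C%C * P i j)); last first.
    by rewrite !mxE /=; case: (P i j) => x y /=; rewrite mul0r addr0.
  rewrite -h; apply: eq_bigr => k _; rewrite !mxE /=.
  by case: (P i k) => x y /=; rewrite mulr0 add0r.
- apply/matrixP => i j.
  have /unitarymxP/matrixP/(_ i j) := Pun; rewrite !mxE => /(congr1 Re).
  rewrite Re_sum /= -big_split /= => h.
  transitivity (Re ((i == j)%:R : R[i]%C)); last by case: (i == j).
  rewrite -h; apply: eq_bigr => k _; rewrite !mxE /=.
  by case: (P i k) => x y; case: (P j k) => z t /=; rewrite mulrN opprK.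
- apply/matrixP => i j.
  have /unitarymxP/mulmx1C/matrixP/(_ i j) := Pun; rewrite !mxE => /(congr1 Re).
  rewrite Re_sum /= -big_split /= => h.
  transitivity (Re ((i == j)%:R : R[i]%C)); last by case: (i == j).
  rewrite -h; apply: eq_bigr => k _; rewrite !mxE /=.
  by case: (P k i) => x y; case: (P k j) => z t /=; rewrite mulNr opprK.
- apply: (@map_poly_inj _ _ (real_complex R)).
  rewrite map_char_poly -/AC AE char_poly_conj //.
  rewrite char_poly_trig ?diag_mx_is_trig // rmorph_prod /=.
  apply: eq_bigr => i _; rewrite rmorphB /= map_polyX map_polyC /=.
  by rewrite mxE eqxx mulr1n DE.
Qed.

(* us consists of the real and the imaginary parts of k complex orthonormal
   eigenvectors, so no real orthonormal eigenbasis has to be extracted from the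
   unitary diagonalisation over R[i]. *)
Lemma Pkminus_frame (k : nat) (A : 'M[R]_n) : A^T = A -> (k <= n)%N ->
  exists us : seq 'rV[R]_n,
    [/\ \sum_(u <- us) (u *m u^T) ord0 ord0 = k%:R,
        forall x : 'rV[R]_n,
          \sum_(u <- us) ((u *m x^T) ord0 ord0) ^+ 2 <= (x *m x^T) ord0 ord0 &
        Pkminus k A = \sum_(u <- us) (u *m A *m u^T) ord0 ord0].
Proof.
move=> Asym kn; have [U [V [d [UA VA nrm bes cp]]]] := real_sym_spectral Asym.
pose e := sort (relpre (d ord0) <=%R) (enum 'I_n).
have pe : perm_eq e (enum 'I_n) by rewrite perm_sort.
have se : size e = n by rewrite size_sort size_enum_ord.
have eigE : eigseq A = map (d ord0) e.
  have isE : is_eigseq A (map (d ord0) e).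
    split; first by rewrite sorted_map; apply: sort_sorted => x y; exact: le_total.
    by rewrite cp big_map (perm_big _ pe) /= big_enum.
  (* The default [[::]] of [xget] is excluded because a sorted list of roots exists; that list is
     unique, as the factorisation determines the multiset of roots. *)
  have [s1 c1] : is_eigseq A (eigseq A) by apply: xgetPex; exists (map (d ord0) e).
  have [s2 c2] := isE.
  apply: (le_sorted_eq s1 s2); apply: prod_XsubC_eq; rewrite -c1 -c2 //.
pose t := take k e.
have PkE : Pkminus k A = \sum_(i <- t) d ord0 i.
  rewrite /Pkminus eigE /t -(big_map (d ord0) predT id) map_take.
  have st : size (take k (map (d ord0) e)) = k by rewrite size_takel // size_map se.
  rewrite (big_nth 0) st big_mkord; apply: eq_bigr => i _.
  by rewrite nth_take.
exists ([seq row i U | i <- t] ++ [seq row i V | i <- t]); split.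
- rewrite big_cat !big_map /= -big_split /=.
  under eq_bigr => i _.
    have -> : (row i U *m (row i U)^T) ord0 ord0 + (row i V *m (row i V)^T) ord0 ord0
       = (U *m U^T + V *m V^T) i i.
      by rewrite !mxE; congr (_ + _); apply: eq_bigr => j _; rewrite !mxE.
    rewrite nrm mxE eqxx.
    over.
  by rewrite big_const_seq count_predT size_takel ?se // iter_addr_0.
- move=> x; rewrite big_cat !big_map /= -big_split /=.
  pose g i := (row i U *m x^T) ord0 ord0 ^+ 2 + (row i V *m x^T) ord0 ord0 ^+ 2.
  have g0 i : 0 <= g i by rewrite addr_ge0 ?sqr_ge0.
  (* Parseval's identity over all indices, from [U^T U + V^T V = 1]; dropping the nonnegative terms
     beyond the first [k] leaves the Bessel inequality. *)
  have -> : (x *m x^T) ord0 ord0 = \sum_(i <- e) g i.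
    rewrite (perm_big _ pe) /= big_enum /=.
    have -> : x *m x^T = (x *m U^T) *m (U *m x^T) + (x *m V^T) *m (V *m x^T).
      by rewrite !mulmxA -mulmxDl -!(mulmxA x) -mulmxDr bes mulmx1.
    rewrite mxE !mxE -big_split /=; apply: eq_bigr => i _; rewrite /g !expr2 !mxE.
    by congr (_ * _ + _ * _); apply: eq_bigr => j _; rewrite !mxE // mulrC.
  rewrite -(cat_take_drop k e) big_cat /= lerDl; apply: sumr_ge0 => i _.
  exact: g0.
- rewrite PkE big_cat !big_map /= -big_split /=; apply: eq_bigr => i _.
  have rdE (W : 'M[R]_n) : row i (diag_mx d *m W) = d ord0 i *: row i W.
    by apply/rowP => j; rewrite mul_diag_mx !mxE.
  rewrite -(row_mul i U A) -(row_mul i V A) UA VA !rdE -!scalemxAl !mxE -mulrDr.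
  have /matrixP/(_ i i) := nrm; rewrite !mxE eqxx => h.
  rewrite mulr1n in h; rewrite -[LHS]mulr1 -[in LHS]h; congr (_ * (_ + _)); apply: eq_bigr => j _; rewrite !mxE //.
Qed.

End RealSpectral.

(** * Strict directional derivatives *)

Lemma nearE_norm (R : realType) (V : normedModType R) (P : set V) (x : V) :
  (\forall y \near x, P y) <->
  exists2 d : R, 0 < d & forall y, `|y - x| < d -> P y.
Proof.
split.
- move=> /nbhs_ballP[d /= d0 dP]; exists d => // y yx; apply: dP.
  by rewrite -ball_normE /= distrC.
- move=> [d d0 dP]; apply/nbhs_ballP; exists d => //= y.
  by rewrite -ball_normE /= distrC => /dP.
Qed.

Lemma continuous_dist (R : realType) (V : normedModType R) (f : V -> R) x :
  {for x, continuous f} -> forall e : R, 0 < e ->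
  exists2 d : R, 0 < d & forall y, `|y - x| < d -> `|f y - f x| < e.
Proof.
move=> /cvgrPdist_lt cf e /cf /nearE_norm[d d0 dP]; exists d => // y /dP.
by rewrite distrC.
Qed.

(** Both signs of [h] are treated at once by writing the intermediate point as [s * h]; for [h = 0]
    any [s] works and [1/2] is taken. *)
Lemma MVT_origin (R : realType) (g dg : R -> R) (h : R) :
  (forall t : R, `|t| <= `|h| -> is_derive t 1 g (dg t)) ->
  exists s, [/\ 0 < s, s < 1 & g h - g 0 = h * dg (s * h)].
Proof.
move=> gd.
have cont (a b : R) : `|a| <= `|h| -> `|b| <= `|h| -> {within `[a, b], continuous g}.
  move=> ah bh; apply: derivable_within_continuous => t; rewrite in_itv /= => tab.
  suff /gd[] : `|t| <= `|h| by [].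
  by move: ah bh tab; rewrite !ler_norml; lra.
have [h0|h0|->] := ltgtP h 0.
- have [||c] := @MVT R g dg h 0 h0.
  + move=> t; rewrite in_itv /= => ?; apply: gd.
    by rewrite (ler0_norm (ltW h0)) ler_norml; lra.
  + by apply: cont; rewrite ?normr0.
  rewrite in_itv /= => ch cE; exists (c / h); split.
  + by rewrite ltr_ndivlMr // mul0r; lra.
  + by rewrite ltr_ndivrMr // mul1r; lra.
  + by rewrite divfK ?lt_eqF // -opprB cE; ring.
- have [||c] := @MVT R g dg 0 h h0.
  + move=> t; rewrite in_itv /= => ?; apply: gd.
    by rewrite (ger0_norm (ltW h0)) ler_norml; lra.
  + by apply: cont; rewrite ?normr0.
  rewrite in_itv /= => ch cE; exists (c / h); split.
  + by rewrite ltr_pdivlMr // mul0r; lra.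
  + by rewrite ltr_pdivrMr // mul1r; lra.
  + by rewrite divfK ?gt_eqF // cE; ring.
- by exists 2^-1; split; [lra|lra|rewrite subrr mul0r].
Qed.

Section DirectionalDerivatives.
Variables (R : realType) (V : normedModType R).
Implicit Types (f df : V -> R) (x y u v : V).

Lemma is_derive_line f y v (t l : R) :
  is_derive (y + t *: v) v f l -> is_derive t 1 (fun s : R => f (y + s *: v)) l.
Proof.
move=> [df dl].
have E : (fun h : R => h^-1 *: (((fun s : R => f (y + s *: v)) \o shift t) (h *: 1) - f (y + t *: v)))
  = (fun h => h^-1 *: ((f \o shift (y + t *: v)) (h *: v) - f (y + t *: v))).
  apply/funext => h /=; congr (_ *: (f _ - _)).
  by rewrite scalerDl addrCA /GRing.scale /= mulr1.
split; first by rewrite /derivable E.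
by rewrite -dl /derive E.
Qed.

(* Strict differentiability in the direction v: the base point of the
   difference quotient may move, which makes the notion additive in v. *)
Definition sderive f x v (l : R) :=
  forall e : R, 0 < e -> exists2 d : R, 0 < d &
    forall y (h : R), `|y - x| < d -> `|h| < d ->
      `|f (y + h *: v) - f y - h * l| <= e * `|h|.

Lemma sderive_is_derive f x v l : sderive f x v l -> is_derive x v f l.
Proof.
move=> fl.
have cvgl : h^-1 *: ((f \o shift x) (h *: v) - f x) @[h --> (0 : R)^'] --> l.
  apply/cvgrPdist_le => e e0; have [d d0 dP] := fl _ e0.
  apply/nbhs_ballP; exists d => //= h; rewrite -ball_normE /= sub0r normrN => hd h0.
  have := dP x h; rewrite subrr normr0 => /(_ d0 hd).
  rewrite -ler_pdivrMr ?normr_gt0 // -normfV -normrM => le_e.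
  rewrite distrC; apply: le_trans le_e; rewrite le_eqVlt; apply/orP; left; apply/eqP.
  by congr `|_|; rewrite (addrC x) /GRing.scale /=; field.
by split; [apply/cvg_ex; exists l|apply/cvg_lim].
Qed.

Lemma sderive0 f x : sderive f x 0 0.
Proof.
move=> e e0; exists 1 => // y h _ _; rewrite scaler0 addr0 subrr mulr0 subr0.
by rewrite normr0 mulr_ge0 // ltW.
Qed.

Lemma sderiveZ f x v l c : sderive f x v l -> sderive f x (c *: v) (c * l).
Proof.
(* The [+ 1] keeps the divisor positive when [c = 0]; the same device recurs below with norms of
   vectors. *)
move=> fl e e0; pose k := `|c| + 1.
have k0 : 0 < k by rewrite ltr_wpDl.
have [d d0 dP] := fl _ (divr_gt0 e0 k0).
exists (Num.min d (d / k)); first by rewrite lt_min d0 divr_gt0.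
move=> y h; rewrite !lt_min => /andP[yd _] /andP[_ hd].
rewrite scalerA mulrA; apply: le_trans (dP _ _ yd _) _.
  rewrite normrM; apply: le_lt_trans (_ : `|h| * k < _).
    by rewrite ler_wpM2l // /k lerDl.
  by rewrite -ltr_pdivlMr.
rewrite normrM (mulrC `|h|) mulrA ler_wpM2r //.
by rewrite mulrAC ler_pdivrMr // ler_wpM2l ?(ltW e0) // /k lerDl.
Qed.

(** The increment along [u + v] is a step along [u] from [y] followed by a step along [v] from
    [y + h *: u]; the second is controlled because the base point is allowed to move. *)
Lemma sderiveD f x u v a b :
  sderive f x u a -> sderive f x v b -> sderive f x (u + v) (a + b).
Proof.
move=> fa fb e e0; pose k := `|u| + 1.
have k0 : 0 < k by rewrite ltr_wpDl.
have e20 : 0 < e / 2 by lra.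
have [d d0 dP] := fa _ e20; have [d' d'0 d'P] := fb _ e20.
exists (Num.min d (Num.min (d' / 2) (d' / 2 / k))).
  by rewrite !lt_min d0 !divr_gt0.
move=> y h; rewrite !lt_min => /and3P[yd yd' _] /and3P[hd hd' hk].
have hu : `|h| * `|u| < d' / 2.
  apply: le_lt_trans (_ : `|h| * k < _); last by rewrite -ltr_pdivlMr.
  by rewrite ler_wpM2l // /k lerDl.
have A1 := dP _ _ yd hd.
have A2 : `|f (y + h *: u + h *: v) - f (y + h *: u) - h * b| <= e / 2 * `|h|.
  apply: d'P; last by lra.
  rewrite addrAC; apply: le_lt_trans (ler_normD _ _) _; rewrite normrZ; lra.
rewrite scalerDr addrA.
have -> : f (y + h *: u + h *: v) - f y - h * (a + b) =
   (f (y + h *: u + h *: v) - f (y + h *: u) - h * b) + (f (y + h *: u) - f y - h * a) by ring.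
apply: le_trans (ler_normD _ _) _; lra.
Qed.

Lemma sderive_sum (I : Type) (r : seq I) f x (v : I -> V) (l : I -> R) :
  (forall i, sderive f x (v i) (l i)) ->
  sderive f x (\sum_(i <- r) v i) (\sum_(i <- r) l i).
Proof.
move=> fl; elim: r => [|i r IH]; first by rewrite !big_nil; exact: sderive0.
by rewrite !big_cons; apply: sderiveD.
Qed.

Lemma sderive_linf f f' x v l l' c : sderive f x v l -> sderive f' x v l' ->
  sderive (fun y => c * f y + f' y) x v (c * l + l').
Proof.
move=> fl fl' e e0; pose k := `|c| + 1.
have k0 : 0 < k by rewrite ltr_wpDl.
have e20 : 0 < e / 2 by lra.
have [d d0 dP] := fl _ (divr_gt0 e20 k0); have [d' d'0 d'P] := fl' _ e20.
exists (Num.min d d'); first by rewrite lt_min d0.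
move=> y h; rewrite !lt_min => /andP[yd yd'] /andP[hd hd'].
have -> : c * f (y + h *: v) + f' (y + h *: v) - (c * f y + f' y) - h * (c * l + l') =
  c * (f (y + h *: v) - f y - h * l) + (f' (y + h *: v) - f' y - h * l') by ring.
apply: le_trans (ler_normD _ _) _; rewrite normrM.
have A1 := dP _ _ yd hd; have A2 := d'P _ _ yd' hd'.
have A3 : `|c| * `|f (y + h *: v) - f y - h * l| <= e / 2 * `|h|.
  apply: le_trans (_ : k * (e / 2 / k * `|h|) <= _).
    by apply: ler_pM => //; rewrite /k lerDl.
  by rewrite mulrA mulrC -[X in _ * X]mulrCA divff ?gt_eqF // mulr1 mulrC.
by apply: le_trans (lerD A3 A2) _; lra.
Qed.

(** The mean value theorem on the segment from [y] to [y + h *: v] turns the difference quotient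
    into a value of [df] near [x]. *)
Lemma sderive_partial f df x v : (\forall y \near x, is_derive y v f (df y)) ->
  {for x, continuous df} -> sderive f x v (df x).
Proof.
move=> /nearE_norm[r r0 rP] cdf e e0.
have [r' r'0 r'P] := continuous_dist cdf e0.
pose k := `|v| + 1; have k0 : 0 < k by rewrite ltr_wpDl.
pose m := Num.min r r'; have m0 : 0 < m by rewrite lt_min r0.
exists (Num.min (m / 2) (m / 2 / k)); first by rewrite lt_min !divr_gt0.
move=> y h; rewrite !lt_min => /andP[ym _] /andP[_ hm].
have hv : `|h| * `|v| < m / 2.
  apply: le_lt_trans (_ : `|h| * k < _); last by rewrite -ltr_pdivlMr.
  by rewrite ler_wpM2l // /k lerDl.
have near_m t : `|t| <= `|h| -> `|y + t *: v - x| < m.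
  move=> th; rewrite addrAC; apply: le_lt_trans (ler_normD _ _) _; rewrite normrZ.
  have : `|t| * `|v| <= `|h| * `|v| by rewrite ler_wpM2r.
  lra.
have [t th|s [s0 s1]] := @MVT_origin R (fun t => f (y + t *: v)) (fun t => df (y + t *: v)) h.
  by apply: is_derive_line; apply: rP; apply: lt_le_trans (near_m _ th) _; rewrite ge_min lexx.
rewrite scale0r addr0 => ->; rewrite -mulrBr normrM mulrC ler_wpM2r // ltW //.
apply: r'P; apply: lt_le_trans (near_m _ _) _; last by rewrite ge_min lexx orbT.
by rewrite normrM gtr0_norm // ler_piMl // ltW.
Qed.

(** The mean value theorem in the direction [u], applied to the increment of [f] along [h *: v],
    leaves an increment of [df] along [v] based at [x + (s * h) *: u]. Strictness of the derivative
    of [df] handles this moving base point. *)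
Lemma second_difference f df x u v a :
  (\forall y \near x, is_derive y u f (df y)) -> sderive df x v a ->
  forall e : R, 0 < e -> exists2 d : R, 0 < d & forall h, `|h| < d ->
    `|f (x + h *: u + h *: v) - f (x + h *: u) - f (x + h *: v) + f x - h ^+ 2 * a|
       <= e * h ^+ 2.
Proof.
move=> /nearE_norm[r r0 rP] dfa e e0.
have [r' r'0 r'P] := dfa _ e0.
pose k := `|u| + `|v| + 1.
have k0 : 0 < k by rewrite ltr_wpDl ?addr_ge0.
pose m := Num.min r r'; have m0 : 0 < m by rewrite lt_min r0.
exists (Num.min m (m / k)); first by rewrite lt_min m0 divr_gt0.
move=> h; rewrite lt_min => /andP[hm hmk].
have hk : `|h| * k < m by rewrite -ltr_pdivlMr.
have hu0 : 0 <= `|h| * `|u| by rewrite mulr_ge0.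
have hv0 : 0 <= `|h| * `|v| by rewrite mulr_ge0.
have huv : `|h| * `|u| + `|h| * `|v| < m by rewrite -mulrDr; apply: le_lt_trans hk; rewrite ler_wpM2l // /k lerDl.
have tu (t : R) : `|t| <= `|h| -> `|t| * `|u| <= `|h| * `|u| by move=> ?; rewrite ler_wpM2r.
have [t th|s [s0 s1]] := @MVT_origin R (fun t => f (x + h *: v + t *: u) - f (x + t *: u))
    (fun t => df (x + h *: v + t *: u) - df (x + t *: u)) h.
- apply: is_deriveB; apply: is_derive_line; apply: rP.
    rewrite -(addrA x) (addrAC x) subrr add0r; apply: le_lt_trans (ler_normD _ _) _; rewrite !normrZ.
    have := tu _ th; have : m <= r by rewrite ge_min lexx.
    lra.
  rewrite addrAC subrr add0r normrZ.
  have := tu _ th; have : m <= r by rewrite ge_min lexx.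
  lra.
rewrite scale0r !addr0 => E.
have -> : f (x + h *: u + h *: v) - f (x + h *: u) - f (x + h *: v) + f x - h ^+ 2 * a =
  h * (df (x + (s * h) *: u + h *: v) - df (x + (s * h) *: u) - h * a).
  rewrite (addrAC x (h *: u)) (addrAC x ((s * h) *: u)).
  transitivity ((f (x + h *: v + h *: u) - f (x + h *: u) - (f (x + h *: v) - f x)) - h ^+ 2 * a); first by ring.
  by rewrite E; ring.
have shh : `|s * h| <= `|h| by rewrite normrM gtr0_norm // ler_piMl // ltW.
have := r'P (x + (s * h) *: u) h; rewrite addrAC subrr add0r normrZ.
have mr' : m <= r' by rewrite ge_min lexx orbT.
have c1 : `|s * h| * `|u| < r' by have := tu _ shh; lra.
have c2 : `|h| < r' by lra.
move=> /(_ c1 c2) B; rewrite normrM -(real_normK (num_real h)) expr2 mulrA mulrC.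
by rewrite ler_wpM2r.
Qed.

(** The second difference is symmetric in [u] and [v], so [a] and [b] are both its limit after
    division by [h ^+ 2]. *)
Lemma second_derivatives_sym f fu fv x u v a b :
  (\forall y \near x, is_derive y u f (fu y)) ->
  (\forall y \near x, is_derive y v f (fv y)) ->
  sderive fu x v a -> sderive fv x u b -> a = b.
Proof.
move=> du dv ua vb; apply/eqP; rewrite -subr_eq0 -normr_le0.
apply/ler_addgt0Pr => e e0; rewrite add0r.
have e20 : 0 < e / 2 by lra.
have [d d0 dP] := second_difference du ua e20.
have [d' d'0 d'P] := second_difference dv vb e20.
pose h := Num.min d d' / 2.
have m0 : 0 < Num.min d d' by rewrite lt_min d0.
have h0 : 0 < h by rewrite divr_gt0.
have hm : `|h| < Num.min d d' by rewrite gtr0_norm // /h; lra.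
have hd : `|h| < d by apply: lt_le_trans hm _; rewrite ge_min lexx.
have hd' : `|h| < d' by apply: lt_le_trans hm _; rewrite ge_min lexx orbT.
have := dP _ hd; have := d'P _ hd'.
rewrite (addrAC x (h *: v)).
set P := f _ => B A.
have h20 : 0 < h ^+ 2 by rewrite exprn_gt0.
rewrite -(ler_pM2r h20) -{1}(gtr0_norm h20) -normrM.
have -> : (a - b) * h ^+ 2 =
  (P - f (x + h *: v) - f (x + h *: u) + f x - h ^+ 2 * b) -
  (P - f (x + h *: u) - f (x + h *: v) + f x - h ^+ 2 * a) by ring.
apply: le_trans (ler_normB _ _) _; lra.
Qed.

End DirectionalDerivatives.

Lemma sderive_sumf (R : realType) (V : normedModType R) (I : Type) (r : seq I)
    (f : I -> V -> R) x v (c l : I -> R) :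
  (forall i, sderive (f i) x v (l i)) ->
  sderive (fun y => \sum_(i <- r) c i * f i y) x v (\sum_(i <- r) c i * l i).
Proof.
move=> fl; elim: r => [|i r IH].
  move=> e e0; exists 1 => // y h _ _; rewrite !big_nil mulr0 !subrr normr0.
  by rewrite mulr_ge0 // ltW.
rewrite big_cons.
have -> : (fun y => \sum_(j <- i :: r) c j * f j y) =
  (fun y => c i * f i y + \sum_(j <- r) c j * f j y).
  by apply/funext => y; rewrite big_cons.
exact: sderive_linf.
Qed.

(** * Hessians of C^2 functions and second order conditions at a touching point *)

Section C2Functions.
Variables (R : realType) (n : nat).
Notation V := 'rV[R]_n.
Implicit Types (f : V -> R) (O : set V) (x v : V).

Definition dirder f v x : R := \sum_i v ord0 i * pd i f x.

Lemma C2_on_is_derive O f x i : C2_on O f -> O x ->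
  is_derive x (evec R i) f (pd i f x).
Proof. by move=> fC Ox; have [_ /(_ i)[/derivableP]] := fC _ Ox. Qed.

Lemma C2_on_is_derive2 O f x i j : C2_on O f -> O x ->
  is_derive x (evec R j) (pd i f) (pd j (pd i f) x).
Proof. by move=> fC Ox; have [_ _ /(_ i j)[/derivableP]] := fC _ Ox. Qed.

Lemma sderive_dirder f x v :
  (forall i, sderive f x (evec R i) (pd i f x)) -> sderive f x v (dirder f v x).
Proof.
move=> fd; rewrite [v in sderive _ _ v _]row_sum_delta.
apply: sderive_sum => i; exact: sderiveZ (fd i).
Qed.

Lemma C2_sderive O f x v : open O -> C2_on O f -> O x ->
  sderive f x v (dirder f v x).
Proof.
move=> oO fC Ox; apply: sderive_dirder => i; apply: sderive_partial.
  by apply: filterS (open_nbhs_nbhs (conj oO Ox)) => y; exact: C2_on_is_derive.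
by have [_ /(_ i)[]] := fC _ Ox.
Qed.

Lemma C2_sderive_pd O f x v i : open O -> C2_on O f -> O x ->
  sderive (pd i f) x v (dirder (pd i f) v x).
Proof.
move=> oO fC Ox; apply: sderive_dirder => j; apply: sderive_partial.
  by apply: filterS (open_nbhs_nbhs (conj oO Ox)) => y; exact: C2_on_is_derive2.
by have [_ _ /(_ i j)[]] := fC _ Ox.
Qed.

Lemma dirder_evec f x i : dirder f (evec R i) x = pd i f x.
Proof.
rewrite /dirder (bigD1 i) //= mxE !eqxx mul1r big1 ?addr0 // => j ji.
by rewrite mxE eqxx (negbTE ji) mul0r.
Qed.

Lemma hessian_sym O f x : open O -> C2_on O f -> O x ->
  (hessian f x)^T = hessian f x.
Proof.
move=> oO fC Ox; apply/matrixP => i j; rewrite !mxE.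
have := C2_sderive_pd (evec R i) j oO fC Ox.
have := C2_sderive_pd (evec R j) i oO fC Ox.
rewrite !dirder_evec => di dj; apply: second_derivatives_sym dj di.
  by apply: filterS (open_nbhs_nbhs (conj oO Ox)) => y; exact: C2_on_is_derive.
by apply: filterS (open_nbhs_nbhs (conj oO Ox)) => y; exact: C2_on_is_derive.
Qed.

Lemma quad_hessian f x v : (v *m hessian f x *m v^T) ord0 ord0 =
  \sum_i v ord0 i * dirder (pd i f) v x.
Proof.
rewrite -mulmxA mxE; apply: eq_bigr => i _; congr (_ * _).
by rewrite mxE; apply: eq_bigr => j _; rewrite !mxE mulrC.
Qed.

Lemma C2_sderive_dirder O f x v : open O -> C2_on O f -> O x ->
  sderive (dirder f v) x v ((v *m hessian f x *m v^T) ord0 ord0).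
Proof.
move=> oO fC Ox; rewrite quad_hessian.
by apply: sderive_sumf => i; apply: C2_sderive_pd Ox.
Qed.

Lemma local_max_order2 O f g x : open O -> C2_on O f -> C2_on O g -> O x ->
  (\forall y \near x, f y - g y <= f x - g x) ->
  (forall i, pd i f x = pd i g x) /\
  forall v, (v *m hessian f x *m v^T) ord0 ord0 <= (v *m hessian g x *m v^T) ord0 ord0.
Proof.
move=> oO fC gC Ox mx.
have [d d0 dP] : exists2 d : R, 0 < d &
    forall y, `|y - x| < d -> O y /\ f y - g y <= f x - g x.
  by apply/nearE_norm; apply: (filterI _ mx); exact: open_nbhs_nbhs (conj oO Ox).
pose F v := fun t : R => f (x + t *: v) - g (x + t *: v).
pose D v y := dirder f v y - dirder g v y.
pose k v := `|v| + 1 : R.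
have k0 v : 0 < k v by rewrite ltr_wpDl.
have nx v (t : R) : `|t| < d / k v -> `|x + t *: v - x| < d.
  rewrite addrAC subrr add0r normrZ ltr_pdivlMr // => h.
  by apply: le_lt_trans h; rewrite ler_wpM2l // lerDl.
have FD v (t : R) : `|t| < d / k v -> is_derive t 1 (F v) (D v (x + t *: v)).
  move=> td; have [Oy _] := dP _ (nx _ _ td).
  by apply: is_deriveB; apply: is_derive_line; apply: sderive_is_derive; apply: C2_sderive Oy.
have D0 v : D v x = 0.
  have r0 : 0 < d / k v by rewrite divr_gt0.
  have F0 : is_derive (0 : R) 1 (F v) 0.
    apply: (@derive1_at_max _ _ (- (d / k v)) (d / k v)).
    - by lra.
    - move=> t; rewrite in_itv /= => tI.
      by have [] : is_derive t 1 (F v) (D v (x + t *: v)) by apply: FD; rewrite ltr_norml.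
    - by rewrite in_itv /=; lra.
    - move=> t; rewrite in_itv /= => tI; rewrite /F scale0r addr0.
      by apply: (dP _ _).2; apply: nx; rewrite ltr_norml.
  have := FD v 0; rewrite normr0 scale0r addr0 => /(_ r0) F1.
  by rewrite -(@derive_val _ _ _ _ _ _ _ F1) (@derive_val _ _ _ _ _ _ _ F0).
split=> [i|v].
  by apply/eqP; rewrite -subr_eq0 -!dirder_evec; apply/eqP; exact: D0.
pose q1 := (v *m hessian f x *m v^T) ord0 ord0.
pose q2 := (v *m hessian g x *m v^T) ord0 ord0.
change (q1 <= q2); rewrite leNgt; apply/negP => gf.
(* If the inequality between the quadratic forms failed, [D v] would vanish at [x] with positive
   slope along [v]. Then [F v] would exceed its value at 0 for small positive arguments, against
   maximality. *)
have e0 : 0 < (q1 - q2) / 2 by lra.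
have Dq : sderive (fun y => -1 * dirder g v y + dirder f v y) x v (-1 * q2 + q1).
  by apply: sderive_linf; apply: C2_sderive_dirder Ox.
have [d' d'0 d'P] := Dq _ e0.
pose m := Num.min (d / k v) d'.
have m0 : 0 < m by rewrite lt_min divr_gt0.
have md : m <= d / k v by rewrite ge_min lexx.
have md' : m <= d' by rewrite ge_min lexx orbT.
have [t|s [s0 s1]] := @MVT_origin R (F v) (fun t => D v (x + t *: v)) (m / 2).
  by move=> tm; apply: FD; apply: le_lt_trans tm _; rewrite gtr0_norm; lra.
set t := s * (m / 2).
have t0 : 0 < t by rewrite mulr_gt0 //; lra.
have tm : t < m by rewrite /t; nra.
have := d'P x t; rewrite subrr normr0 gtr0_norm // => /(_ d'0)/(_ (lt_le_trans tm md')).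
rewrite ler_norml => /andP[lb _] E.
have Dx : D v x = 0 := D0 v.
have Dt : 0 < D v (x + t *: v) by move: Dx; rewrite /D; nra.
have : F v (m / 2) - F v 0 <= 0.
  rewrite /F scale0r addr0 subr_le0; apply: (dP _ _).2; apply: nx.
  by rewrite gtr0_norm; lra.
by rewrite E leNgt mulr_gt0 //; lra.
Qed.

End C2Functions.

(** * The radial profile *)

(** The integral starts at [a] and is differentiable strictly to its right; a negative [a] therefore
    gives a two-sided derivative at 0, the squared distance at the centre of a ball. *)
Lemma continuous_primitive (R : realType) (f : R -> R) (a : R) : continuous f ->
  exists F : R -> R, forall x : R, a < x -> is_derive x 1 F (f x).
Proof.
move=> cf; pose mu := @lebesgue_measure R.
exists (fun x => (\int[mu]_(t in [set` `[a, x]]) (f t))%R) => x ax.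
have fi : mu.-integrable `[a, x + 1] (EFin \o f).
  apply: continuous_compact_integrable; first exact: segment_compact.
  exact: continuous_subspaceT.
have xu : x < x + 1 by rewrite ltrDl.
have [dF FE] := continuous_FTC1_closed xu fi ax (cf x).
by split; [exact: dF|rewrite -derive1E; exact: FE].
Qed.

Section RadialProfile.
Variables (R : realType).
Implicit Types (s r h : R).

Definition tau r s : R := Num.sqrt (s + r ^+ 2).

(* profile_d and profile_dd are the first and second derivatives of the radial
   profile with respect to s = |x - c|^2. *)
Definition profile_d (m : nat) r h s : R :=
  (r * (tau r s)^-1) ^+ m * expR (h * tau r s).

Definition profile_dd (m : nat) r h s : R :=
  profile_d m r h s * (h * (tau r s)^-1 - m%:R * (tau r s)^-1 ^+ 2) / 2.

Lemma is_derive_comp1 (f g : R -> R) (x a b : R) :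
  is_derive x 1 g a -> is_derive (g x) 1 f b ->
  is_derive x 1 (fun y => f (g y)) (b * a).
Proof. move=> dg df; exact: (@is_derive1_comp _ f g). Qed.

Lemma is_derive_cmul (g : R -> R) (x a c : R) :
  is_derive x 1 g a -> is_derive x 1 (fun y => c * g y) (c * a).
Proof. move=> dg; exact: (is_deriveZ c dg). Qed.

Lemma is_derive_continuous (f : R -> R) (x a : R) :
  is_derive x 1 f a -> {for x, continuous f}.
Proof. by move=> [df _]; apply/differentiable_continuous/derivable1_diffP. Qed.

Section Positive.
Variables (r : R) (r0 : 0 < r).

Lemma tau_gt0 s : 0 <= s -> 0 < tau r s.
Proof. by move=> s0; rewrite sqrtr_gt0 ltr_wpDl // exprn_gt0. Qed.

Lemma sqr_tau s : 0 <= s -> tau r s ^+ 2 = s + r ^+ 2.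
Proof. by move=> s0; rewrite sqr_sqrtr // addr_ge0 // sqr_ge0. Qed.

Lemma is_derive_tau s : 0 <= s -> is_derive s 1 (tau r) (2^-1 * (tau r s)^-1).
Proof.
move=> s0; rewrite -[_ * _]mulr1 -invfM.
apply: (@is_derive_comp1 Num.sqrt (fun s => s + r ^+ 2)).
  by apply: is_derive_eq; rewrite addr0.
by apply: is_derive1_sqrt; rewrite ltr_wpDl // exprn_gt0.
Qed.

Lemma is_derive_tauV s : 0 <= s ->
  is_derive s 1 (fun s => (tau r s)^-1) (- (2^-1 * (tau r s)^-1 ^+ 3)).
Proof.
move=> s0; have dt := is_derive_tau s0.
have tn : tau r s != 0 by rewrite gt_eqF // tau_gt0.
apply: (is_derive_eq (@realfun.is_deriveV R (tau r) s _ 1 tn dt)).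
by rewrite /GRing.scale /=; field.
Qed.

Lemma is_derive_profile_d m h s : 0 <= s ->
  is_derive s 1 (profile_d m r h) (profile_dd m r h s).
Proof.
move=> s0; have dt := is_derive_tau s0; have dv := is_derive_tauV s0.
have d1 : is_derive s 1 (fun s => (r * (tau r s)^-1) ^+ m)
   (m%:R * (r * (tau r s)^-1) ^+ m.-1 * (r * - (2^-1 * (tau r s)^-1 ^+ 3))).
  apply: (@is_derive_comp1 (fun y => y ^+ m) (fun s => r * (tau r s)^-1)).
  split; first exact: exprn_derivable.
  by rewrite exp_derive /GRing.scale /= mulr1.
have d2 : is_derive s 1 (fun s => expR (h * tau r s))
   (expR (h * tau r s) * (h * (2^-1 * (tau r s)^-1))).
  by apply: (@is_derive_comp1 expR (fun s => h * tau r s)).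
apply: (is_derive_eq (is_deriveM d1 d2)).
rewrite /profile_dd /profile_d /GRing.scale /=.
(* For [m = 0] the exponent [m.-1] is truncated, but its coefficient [m%:R] vanishes. *)
by case: m {d1} => [|m]; rewrite ?exprS /=; ring.
Qed.

(** The absolute value extends the profile continuously to negative arguments, so that it has a
    primitive around 0. *)
Lemma continuous_profile_d_norm m h : continuous (fun s => profile_d m r h `|s|).
Proof.
move=> s; apply: (@continuous_comp _ _ _ (fun s : R => `|s|) (profile_d m r h)); first exact: norm_continuous.
exact: is_derive_continuous (is_derive_profile_d m h (normr_ge0 s)).
Qed.

Lemma continuous_profile_dd m h s : 0 <= s -> {for s, continuous (profile_dd m r h)}.
Proof.
move=> s0; have cz := is_derive_continuous (is_derive_tauV s0).
have cp := is_derive_continuous (is_derive_profile_d m h s0).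
apply: cvgM; last exact: cvg_cst.
apply: cvgM; first exact: cp.
apply: cvgB; first by apply: cvgM; [exact: cvg_cst|exact: cz].
by apply: cvgM; [exact: cvg_cst|apply: cvgM; exact: cz].
Qed.

Lemma profile_d_ge0 m h s : 0 <= s -> 0 <= profile_d m r h s.
Proof.
move=> s0; rewrite mulr_ge0 ?expR_ge0 // exprn_ge0 // mulr_ge0 ?(ltW r0) //.
by rewrite invr_ge0 ltW // tau_gt0.
Qed.

Section Supersolution.
Variables (m k : nat) (a h Rd : R).
Hypotheses (mk : (m <= k)%N) (h0 : 0 <= h) (hRd : h * Rd = a) (a0 : 0 <= a) (ak : a < k%:R).
Variables (s : R).
Hypotheses (s0 : 0 <= s) (sRd : Num.sqrt s <= Rd).

Let z := (tau r s)^-1.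
Let q := Num.sqrt s.

Let z0 : 0 < z. Proof. by rewrite invr_gt0 tau_gt0. Qed.
Let q0 : 0 <= q. Proof. exact: sqrtr_ge0. Qed.
Let qE : q ^+ 2 = s. Proof. by rewrite sqr_sqrtr. Qed.
Let zE : z ^+ 2 * s + (r * z) ^+ 2 = 1.
Proof.
rewrite exprMn (mulrC (r ^+ 2)) -mulrDr -sqr_tau // -exprMn mulVf ?expr1n //.
by rewrite gt_eqF // tau_gt0.
Qed.
Let hq : h * q <= a. Proof. by rewrite -hRd ler_wpM2l. Qed.

Let rz1 : (r * z) ^+ 2 <= 1.
Proof. by rewrite -zE lerDr mulr_ge0 // sqr_ge0. Qed.

(* The Hessian of phi (|x|^2) is 2 phi' I + 4 phi'' x^T x: a family orthogonal to
   x sees only the first term (profile_tangential), a family containing the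
   direction of x sees both (profile_radial).  These are the two extreme cases. *)
Lemma profile_tangential :
  profile_d m r h s * ((k%:R - a) * (r * z) ^+ 2) <=
  k%:R * profile_d m r h s - h * q * profile_d m r h s.
Proof.
rewrite -mulrBl mulrC ler_wpM2r ?profile_d_ge0 //.
apply: le_trans (_ : k%:R - a <= _); last by have := hq; lra.
by rewrite ler_piMr // subr_ge0 ltW.
Qed.

Lemma profile_radial :
  profile_d m r h s * ((k%:R - a) * (r * z) ^+ 2) <=
  k%:R * profile_d m r h s + 2 * profile_dd m r h s * s - h * q * profile_d m r h s.
Proof.
have -> : k%:R * profile_d m r h s + 2 * profile_dd m r h s * s - h * q * profile_d m r h s
  = profile_d m r h s * (k%:R + (h * z - m%:R * z ^+ 2) * s - h * q).
  by rewrite /profile_dd -/z; field.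
rewrite ler_wpM2l ?profile_d_ge0 //.
have qz0 : 0 <= q * z by rewrite mulr_ge0 // ltW.
have qz2 : (q * z) ^+ 2 + (r * z) ^+ 2 = 1 by rewrite exprMn qE mulrC.
have qz1 : q * z <= 1 by have := sqr_ge0 (r * z); nra.
(* The [h]-part of [profile_dd] cancels the fraction [q * z] of the gradient term. Since
   [0 <= q * z <= 1], the rest satisfies [1 - q z <= 1 - (q z)^2 = (r z)^2]. *)
have A1 : h * q * (1 - q * z) <= a * (r * z) ^+ 2.
  apply: le_trans (_ : a * (1 - q * z) <= _); first by rewrite ler_wpM2r // subr_ge0.
  by rewrite ler_wpM2l //; nra.
have A2 : m%:R * (z ^+ 2 * s) <= k%:R * (z ^+ 2 * s).
  by rewrite ler_wpM2r ?ler_nat // mulr_ge0 // sqr_ge0.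
have A3 : h * z * s = h * q * (q * z) by rewrite -qE; ring.
have A4 : k%:R * (z ^+ 2 * s) + k%:R * (r * z) ^+ 2 = k%:R by rewrite -mulrDr zE mulr1.
rewrite mulrBl (mulrBl s) A3 -(mulrA m%:R); lra.
Qed.

(** Inside the ball [(r z)^2 >= 1/2], hence [(r z)^m >= (r z)^4 >= 1/4], and the exponential is at
    least 1; the 8 is the product of 4 and 2. *)
Lemma profile_core : (m <= 4)%N -> s < r ^+ 2 ->
  (k%:R - a) / 8 <= profile_d m r h s * ((k%:R - a) * (r * z) ^+ 2).
Proof.
move=> m4 sr.
have u0 : 0 <= r * z by rewrite mulr_ge0 ?(ltW r0) ?(ltW z0).
have u1 : r * z <= 1 by rewrite -(@ler_pXn2r _ 2) ?nnegrE // expr1n.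
have u2 : 2^-1 <= (r * z) ^+ 2.
  have : z ^+ 2 * s <= z ^+ 2 * r ^+ 2 by rewrite ler_wpM2l ?sqr_ge0 // ltW.
  move: zE; rewrite exprMn mulrC => ? ?; lra.
have um : 4^-1 <= profile_d m r h s.
  apply: le_trans (_ : (r * z) ^+ m <= _).
    apply: le_trans (_ : (r * z) ^+ 4 <= _).
      by rewrite (exprM _ 2 2); nra.
    by rewrite ler_wiXn2l.
  rewrite /profile_d ler_peMr ?exprn_ge0 //.
  rewrite -[1]expR0 ler_expR mulr_ge0 // ltW // tau_gt0 //.
have c0 : 0 <= k%:R - a by rewrite subr_ge0 ltW.
have B1 : (k%:R - a) * 2^-1 <= (k%:R - a) * (r * z) ^+ 2 by rewrite ler_wpM2l.
apply: le_trans (_ : 4^-1 * ((k%:R - a) * 2^-1) <= _); first lra.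
by apply: ler_pM => //; lra.
Qed.

End Supersolution.
End Positive.
End RadialProfile.

Lemma ge0_derive_le (R : realType) (g dg : R -> R) (a b : R) : a <= b ->
  (forall t, a <= t <= b -> is_derive t 1 g (dg t)) ->
  (forall t, a <= t <= b -> 0 <= dg t) -> g a <= g b.
Proof.
move=> ab gd dg0.
have cg : {within `[a, b], continuous g}.
  by apply: derivable_within_continuous => t; rewrite in_itv /= => /gd[].
have gd' t : t \in `]a, b[ -> is_derive t 1 g (dg t).
  by rewrite in_itv /= => /andP[at_ tb]; apply: gd; rewrite !ltW.
have [c] := MVT_segment ab gd' cg.
rewrite in_itv /= => cab gE.
by rewrite -subr_ge0 gE mulr_ge0 ?subr_ge0 // dg0.
Qed.

(** * Integration of the radial profile and its comparison with [Psi] *)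

Section ProfilePotential.
Variables (R : realType) (r Rd : R).
Hypotheses (r0 : 0 < r) (rRd : r <= Rd / 2).

Let Rd0 : 0 < Rd. Proof. by have := r0; have := rRd; lra. Qed.

Lemma tau_le s : 0 <= s <= Rd ^+ 2 -> tau r s <= 2 * Rd.
Proof.
move=> /andP[s0 sS]; rewrite -(@ler_pXn2r _ 2) ?nnegrE ?(ltW (tau_gt0 r0 s0)) //.
  by rewrite sqr_tau //; have := r0; have := rRd; have := Rd0; nra.
by rewrite mulr_ge0 // ltW.
Qed.

Lemma le_tau s : 0 <= s -> r <= tau r s.
Proof.
move=> s0; rewrite -(@ler_pXn2r _ 2) ?nnegrE ?(ltW (tau_gt0 r0 s0)) ?(ltW r0) //.
by rewrite sqr_tau // lerDr.
Qed.

(** Without the exponential the profile has an explicit primitive: [2 r tau] for [k = 1],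
    [r^2 ln (tau^2)] for [k = 2] and [- 2 r^3 / tau] for [k >= 3]. Each regime of [Psi] is the size
    of its increment over [[0, Rd^2]]. *)
Lemma profile_majorant (k : nat) : (0 < k)%N -> exists P : R -> R,
  (forall s : R, 0 <= s -> is_derive s 1 P ((r * (tau r s)^-1) ^+ minn k 3)) /\
  (forall s : R, 0 <= s <= Rd ^+ 2 -> P (Rd ^+ 2) - P s <= 4 * Psi k Rd r).
Proof.
move=> k0; have S0 : 0 <= Rd ^+ 2 by rewrite sqr_ge0.
case: k k0 => [//|[|[|k]]] _; rewrite /Psi /=.
- exists (fun s => 2 * r * tau r s); split=> [s s0|s sS].
    apply: (is_derive_eq (is_derive_cmul (2 * r) (is_derive_tau r0 s0))).
    by rewrite expr1; field; rewrite gt_eqF // tau_gt0.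
  have /andP[s0 _] := sS.
  have A : tau r (Rd ^+ 2) <= 2 * Rd by apply: tau_le; rewrite S0 lexx.
  have B := tau_gt0 r0 s0.
  rewrite -mulrBr; apply: le_trans (_ : 2 * r * (2 * Rd) <= _); last by lra.
  by rewrite ler_wpM2l //; [have := r0|]; lra.
- exists (fun s => r ^+ 2 * ln (s + r ^+ 2)); split=> [s s0|s /andP[s0 sS]].
    have sr : 0 < s + r ^+ 2 by rewrite ltr_wpDl // exprn_gt0.
    have d1 : is_derive s 1 (fun s => ln (s + r ^+ 2)) ((s + r ^+ 2)^-1 * 1).
      apply: (@is_derive_comp1 _ (@ln R) (fun s => s + r ^+ 2)); last exact: is_derive1_ln.
      by apply: is_derive_eq; rewrite addr0.
    apply: (is_derive_eq (is_derive_cmul (r ^+ 2) d1)).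
    by rewrite mulr1 exprMn exprVn sqr_tau.
  rewrite -mulrBr mulrCA ler_wpM2l ?sqr_ge0 //.
  have q0 : 0 < Rd / r by rewrite divr_gt0.
  have q2 : 2 <= Rd / r by rewrite ler_pdivlMr //; have := rRd; lra.
  rewrite ger0_norm; last by apply: ln_ge0; lra.
  have r20 : 0 < r ^+ 2 by rewrite exprn_gt0.
  have A : ln (r ^+ 2) <= ln (s + r ^+ 2).
    have sr : 0 < s + r ^+ 2 by rewrite ltr_wpDl.
    by rewrite ler_ln ?posrE // lerDr.
  (* Here [Rd / r >= 2] absorbs the sum into a pure power; the exponent 4 becomes the factor in
     front of [Psi]. *)
  have B : ln (Rd ^+ 2 + r ^+ 2) <= ln ((Rd / r) ^+ 4 * r ^+ 2).
    have sr : 0 < Rd ^+ 2 + r ^+ 2 by rewrite ltr_wpDl.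
    rewrite ler_ln ?posrE //; last by rewrite mulr_gt0 // exprn_gt0.
    have -> : (Rd / r) ^+ 4 * r ^+ 2 = (Rd / r) ^+ 2 * Rd ^+ 2.
      by field; rewrite gt_eqF.
    have : 4 <= (Rd / r) ^+ 2 by nra.
    have : r ^+ 2 <= Rd ^+ 2 by have := r0; have := rRd; nra.
    by nra.
  rewrite lnM ?posrE ?exprn_gt0 // lnXn // in B.
  by rewrite mulr_natl; lra.
- exists (fun s => (- (2 * r ^+ 3)) * (tau r s)^-1); split=> [s s0|s /andP[s0 sS]].
    apply: (is_derive_eq (is_derive_cmul _ (is_derive_tauV r0 s0))).
    by rewrite exprMn; field; rewrite gt_eqF // tau_gt0.
  have A : 0 <= (tau r (Rd ^+ 2))^-1 by rewrite invr_ge0 ltW // tau_gt0.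
  have B : r * (tau r s)^-1 <= 1 by rewrite ler_pdivrMr ?tau_gt0 // mul1r le_tau.
  have C : r ^+ 2 * (r * (tau r s)^-1) <= r ^+ 2 by rewrite ler_piMr ?sqr_ge0.
  have D : 0 <= 2 * r ^+ 3 * (tau r (Rd ^+ 2))^-1.
    by rewrite mulr_ge0 // mulr_ge0 // exprn_ge0 // ltW.
  have E := sqr_ge0 r.
  have -> : - (2 * r ^+ 3) / tau r (Rd ^+ 2) - - (2 * r ^+ 3) / tau r s =
    2 * (r ^+ 2 * (r * (tau r s)^-1)) - 2 * r ^+ 3 * (tau r (Rd ^+ 2))^-1 by ring.
  by lra.
Qed.

(** On [[0, Rd^2]] one has [tau <= 2 Rd], so the exponential factor is at most [K = exp (2 h Rd)]
    and the increments of the primitive are at most [K] times those of [P]. Normalising at [Rd^2],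
    where the increasing primitive is set to 0, gives the sign. *)
Lemma profile_potential (k : nat) (h : R) : (0 < k)%N -> 0 <= h ->
  exists phi : R -> R,
  (forall s : R, 0 <= s -> is_derive s 1 phi (profile_d (minn k 3) r h s)) /\
  (forall s : R, 0 <= s <= Rd ^+ 2 ->
     - (4 * expR (2 * (h * Rd)) * Psi k Rd r) <= phi s <= 0).
Proof.
move=> k0 h0; set m := minn k 3.
have [F FE] := @continuous_primitive _ _ (-1) (@continuous_profile_d_norm _ _ r0 m h).
have {}FE (s : R) : 0 <= s -> is_derive s 1 F (profile_d m r h s).
  by move=> s0; rewrite -[in profile_d _ _ _ _](ger0_norm s0); apply: FE; lra.
have [P [PE PB]] := profile_majorant k0.
set K := expR (2 * (h * Rd)).
exists (fun s => F s - F (Rd ^+ 2)); split=> [s s0|s /andP[s0 sS]].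
  by apply: (is_derive_eq (is_deriveB (FE s s0) (is_derive_cst (F (Rd ^+ 2)) s 1))); rewrite subr0.
have FF : F s <= F (Rd ^+ 2).
  apply: (@ge0_derive_le _ _ (profile_d m r h)) => // t /andP[st _].
    by apply: FE; lra.
  by apply: (profile_d_ge0 r0); lra.
have PF : K * P s - F s <= K * P (Rd ^+ 2) - F (Rd ^+ 2).
  apply: (@ge0_derive_le _ (fun t => K * P t - F t)
    (fun t => K * (r * (tau r t)^-1) ^+ m - profile_d m r h t) _ _ sS) => t /andP[st tS].
    have t0 : 0 <= t by lra.
    exact: (is_deriveB (is_derive_cmul K (PE t t0)) (FE t t0)).
  have t0 : 0 <= t by lra.
  rewrite subr_ge0 /profile_d mulrC ler_wpM2r //.
    by rewrite exprn_ge0 // mulr_ge0 ?(ltW r0) // invr_ge0 ltW // tau_gt0.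
  by rewrite ler_expR mulrCA ler_wpM2l // tau_le // t0 tS.
have PB' : K * (P (Rd ^+ 2) - P s) <= K * (4 * Psi k Rd r).
  by rewrite ler_wpM2l ?expR_ge0 // PB // s0 sS.
by apply/andP; split; nra.
Qed.

End ProfilePotential.

(** * Second order jets *)

Lemma continuous_sumf (R : realType) (T : topologicalType) (I : Type)
    (r : seq I) (f : I -> T -> R) : (forall i, continuous (f i)) ->
  continuous (fun x => \sum_(i <- r) f i x).
Proof.
move=> cf; elim: r => [|i r IH].
  by under eq_fun do rewrite big_nil; move=> x; exact: cvg_cst.
under eq_fun do rewrite big_cons.
by move=> x; apply: cvgD; [exact: cf|exact: IH].
Qed.

(** * The Euclidean norm and its comparison with the sup norm *)

Section EuclideanNorm.
Variables (R : realType) (n : nat).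
Notation V := 'rV[R]_n.
Implicit Types (u v x y c : V).

Lemma sqr_enorm v : enorm v ^+ 2 = \sum_i v ord0 i ^+ 2.
Proof. by rewrite sqr_sqrtr // sumr_ge0 // => i _; exact: sqr_ge0. Qed.

Lemma enorm_ge0 v : 0 <= enorm v.
Proof. exact: sqrtr_ge0. Qed.

Lemma mulmx_trE u v : (u *m v^T) ord0 ord0 = \sum_i u ord0 i * v ord0 i.
Proof. by rewrite mxE; apply: eq_bigr => i _; rewrite mxE. Qed.

Lemma enorm_mulmx v : (v *m v^T) ord0 ord0 = enorm v ^+ 2.
Proof. by rewrite mulmx_trE sqr_enorm. Qed.

Lemma enormZ (a : R) v : enorm (a *: v) = `|a| * enorm v.
Proof.
rewrite -sqrtr_sqr -sqrtrM ?sqr_ge0 // mulr_sumr; congr Num.sqrt.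
by apply: eq_bigr => i _; rewrite mxE exprMn.
Qed.

Lemma enorm0 : enorm (0 : V) = 0.
Proof. by rewrite -(scale0r (0 : V)) enormZ normr0 mul0r. Qed.

Lemma coord_le_enorm v i : `|v ord0 i| <= enorm v.
Proof.
rewrite -sqrtr_sqr ler_wsqrtr // (bigD1 i) //= lerDl.
by apply: sumr_ge0 => j _; exact: sqr_ge0.
Qed.

Lemma norm_le_enorm v : `|v| <= enorm v.
Proof.
rewrite [leLHS]/Num.Def.normr /= mx_normrE; apply: bigmax_le; first exact: enorm_ge0.
by move=> [i j] _ /=; rewrite (ord1 i) coord_le_enorm.
Qed.

Lemma cauchy_schwarz u v : \sum_i u ord0 i * v ord0 i <= enorm u * enorm v.
Proof.
set C := \sum_i _.
have [u0|u0] := eqVneq (enorm u) 0.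
  rewrite u0 mul0r /C big1 // => i _.
  by have := coord_le_enorm u i; rewrite u0 normr_le0 => /eqP ->; rewrite mul0r.
have [v0|v0] := eqVneq (enorm v) 0.
  rewrite v0 mulr0 /C big1 // => i _.
  by have := coord_le_enorm v i; rewrite v0 normr_le0 => /eqP ->; rewrite mulr0.
have {}u0 : 0 < enorm u by rewrite lt_def u0 enorm_ge0.
have {}v0 : 0 < enorm v by rewrite lt_def v0 enorm_ge0.
have key (s t : R) : 0 <= s ^+ 2 * enorm u ^+ 2 - 2 * s * t * C + t ^+ 2 * enorm v ^+ 2.
  rewrite !sqr_enorm /C !mulr_sumr -sumrB -big_split /=.
  apply: sumr_ge0 => i _; have := sqr_ge0 (s * u ord0 i - t * v ord0 i).
  by rewrite sqrrB !exprMn mulr2n; lra.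
(* With these weights the quadratic expression factors through [enorm u * enorm v - C]. *)
have := key (enorm v) (enorm u).
have -> : enorm v ^+ 2 * enorm u ^+ 2 - 2 * enorm v * enorm u * C +
     enorm u ^+ 2 * enorm v ^+ 2 = (2 * (enorm u * enorm v)) * (enorm u * enorm v - C) by ring.
by rewrite pmulr_rge0 ?subr_ge0 // !mulr_gt0.
Qed.

Lemma enormD u v : enorm (u + v) <= enorm u + enorm v.
Proof.
rewrite -(@ler_pXn2r _ 2) ?nnegrE ?addr_ge0 ?enorm_ge0 //.
rewrite sqrrD !sqr_enorm.
apply: le_trans (_ : \sum_i (u ord0 i ^+ 2 + (u ord0 i * v ord0 i) *+ 2 + v ord0 i ^+ 2) <= _).
  by apply: ler_sum => i _; rewrite mxE sqrrD.
by rewrite !big_split /= mulr2n lerD2r lerD2l lerD // cauchy_schwarz.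
Qed.

End EuclideanNorm.

Section Jets.
Variables (R : realType) (n : nat).
Notation V := 'rV[R]_n.
Implicit Types (w : V -> R) (g : V -> V) (H : V -> 'M[R]_n).

(** Gradient and Hessian are carried as data on the whole space: sums of barriers are then sums of
    jets, and the derivatives themselves serve as continuous extensions to the closure. *)
Definition C2_jet w g H : Prop :=
  [/\ forall x i, is_derive x (evec R i) w (g x ord0 i),
      forall x i j, is_derive x (evec R j) (fun y => g y ord0 i) (H x i j),
      continuous w,
      forall i, continuous (fun x => g x ord0 i) &
      forall i j, continuous (fun x => H x i j)].

Lemma jet_pd w g H i : C2_jet w g H -> pd i w = fun x => g x ord0 i.
Proof. by move=> [dw _ _ _ _]; apply/funext => x; have [] := dw x i. Qed.

Lemma jet_pd2 w g H i j : C2_jet w g H -> pd j (pd i w) = fun x => H x i j.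
Proof.
move=> wj; rewrite (jet_pd i wj); have [_ dg _ _ _] := wj.
by apply/funext => x; have [] := dg x i j.
Qed.

Lemma jet_hessian w g H x : C2_jet w g H -> hessian w x = H x.
Proof. by move=> wj; apply/matrixP => i j; rewrite mxE (jet_pd2 i j wj). Qed.

Lemma jet_C2_on O w g H : C2_jet w g H -> C2_on O w.
Proof.
move=> wj x _; have [dw dg cw cg cH] := wj; split; first exact: cw.
  by move=> i; rewrite (jet_pd i wj); split; [have [] := dw x i|exact: cg].
move=> i j; rewrite (jet_pd2 i j wj) (jet_pd i wj).
by split; [have [] := dg x i j|exact: cH].
Qed.

Lemma jet_C2_closure O w g H : C2_jet w g H -> C2_closure O w.
Proof.
move=> wj; have [dw dg cw cg cH] := wj; split; first exact: jet_C2_on wj.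
- exact: continuous_subspaceT.
- move=> i; exists (pd i w); split=> //; rewrite (jet_pd i wj).
  exact/continuous_subspaceT/cg.
- move=> i j; exists (pd j (pd i w)); split=> //; rewrite (jet_pd2 i j wj).
  exact/continuous_subspaceT/cH.
Qed.

Lemma jet_cst (c : R) : C2_jet (fun=> c) (fun=> 0) (fun=> 0).
Proof.
have z1 i : (fun _ : V => (0 : V) ord0 i) = fun=> 0 by apply/funext => y; rewrite mxE.
have z2 i j : (fun _ : V => (0 : 'M[R]_n) i j) = fun=> 0 by apply/funext => y; rewrite mxE.
split=> [x i|x i j||i|i j] /=.
- by rewrite mxE; exact: is_derive_cst.
- by rewrite z1 mxE; exact: is_derive_cst.
- exact: cst_continuous.
- by rewrite z1; exact: cst_continuous.
- by rewrite z2; exact: cst_continuous.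
Qed.

Lemma jetD w1 g1 H1 w2 g2 H2 : C2_jet w1 g1 H1 -> C2_jet w2 g2 H2 ->
  C2_jet (fun x => w1 x + w2 x) (fun x => g1 x + g2 x) (fun x => H1 x + H2 x).
Proof.
move=> [a1 a2 a3 a4 a5] [b1 b2 b3 b4 b5]; split=> [x i|x i j|x|i|i j].
- by rewrite mxE; exact: is_deriveD (a1 x i) (b1 x i).
- rewrite [X in is_derive _ _ _ X]mxE; under eq_fun do rewrite mxE.
  exact: is_deriveD (a2 x i j) (b2 x i j).
- exact: (cvgD (a3 x) (b3 x)).
- under eq_fun do rewrite mxE.
  by move=> x; exact: (cvgD (a4 i x) (b4 i x)).
- under eq_fun do rewrite mxE.
  by move=> x; exact: (cvgD (a5 i j x) (b5 i j x)).
Qed.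

Lemma is_derive_of_line (f : V -> R) x v (l : R) :
  is_derive (0 : R) 1 (fun t : R => f (x + t *: v)) l -> is_derive x v f l.
Proof.
have E : (fun h : R => h^-1 *: (((fun t : R => f (x + t *: v)) \o shift 0) (h *: 1) - f (x + 0 *: v)))
  = (fun h : R => h^-1 *: ((f \o shift x) (h *: v) - f x)).
  apply/funext => h /=; rewrite scale0r !addr0; congr (_ *: (f _ - _)).
  by rewrite addrC /GRing.scale /= mulr1.
by move=> [df <-]; split; [move: df; rewrite /derivable E|rewrite /derive E].
Qed.

Lemma is_derive_comp_real (f : R -> R) (q : V -> R) x v (a b : R) :
  is_derive x v q a -> is_derive (q x) 1 f b ->
  is_derive x v (fun y => f (q y)) (b * a).
Proof.
move=> dq df; apply: is_derive_of_line.
have dq' : is_derive (0 : R) 1 (fun t : R => q (x + t *: v)) a.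
  by apply: is_derive_line; rewrite scale0r addr0.
by apply: (is_derive_comp1 dq'); rewrite scale0r addr0.
Qed.

Lemma is_derive_coord x v (c : V) i :
  is_derive x v (fun y : V => (y - c) ord0 i) (v ord0 i).
Proof.
apply: is_derive_of_line.
have -> : (fun t : R => (x + t *: v - c) ord0 i) =
  (fun t : R => v ord0 i * t + (x - c) ord0 i).
  by apply/funext => t; rewrite !mxE; ring.
apply: (is_derive_eq (is_deriveD (is_derive_cmul (v ord0 i) (is_derive_id (0 : R) 1))
  (is_derive_cst ((x - c) ord0 i) (0 : R) 1))).
by rewrite addr0 mulr1.
Qed.

Definition sqdist (c x : V) : R := \sum_i (x - c) ord0 i ^+ 2.

Lemma sqdist_ge0 c x : 0 <= sqdist c x.
Proof. by apply: sumr_ge0 => i _; exact: sqr_ge0. Qed.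

Lemma is_derive_sqdist c x i :
  is_derive x (evec R i) (sqdist c) (2 * (x - c) ord0 i).
Proof.
have -> : sqdist c = \sum_j (fun y : V => (y - c) ord0 j ^+ 2).
  by apply/funext => y; rewrite fct_sumE.
have dj j : is_derive x (evec R i) (fun y : V => (y - c) ord0 j ^+ 2)
    (2 * (x - c) ord0 j * (evec R i) ord0 j).
  apply: (@is_derive_comp_real (fun t => t ^+ 2)); first exact: is_derive_coord.
  split; first exact: exprn_derivable.
  by rewrite exp_derive expr1 /GRing.scale /= mulr1.
apply: (is_derive_eq (is_derive_sum dj)).
rewrite (bigD1 i) //= big1 ?addr0 => [|j ji].
  by rewrite [evec R i]/(delta_mx _ _) !mxE !eqxx mulr1.
by rewrite [evec R i]/(delta_mx _ _) [X in _ * X]mxE (negbTE ji) andbF mulr0.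
Qed.

Lemma continuous_coordB c i : continuous (fun y : V => (y - c) ord0 i).
Proof.
have -> : (fun y : V => (y - c) ord0 i) = (fun y => y ord0 i - c ord0 i).
  by apply/funext => y; rewrite !mxE.
move=> x; have cx := @coord_continuous R 1 n ord0 i x.
exact: (cvgB cx (cvg_cst _)).
Qed.

Lemma continuous_sqdist c : continuous (sqdist c).
Proof.
apply: continuous_sumf => i y; have cy := @continuous_coordB c i y.
exact: (cvgM cy cy).
Qed.

(** The chain rule through the polynomial [sqdist c] avoids the singularity of the distance at [c];
    the profile only has to be regular at points [s >= 0], the range of [sqdist c]. *)
Lemma jet_radial (phi psi chi : R -> R) (c : V) :
  (forall s : R, 0 <= s -> is_derive s 1 phi (psi s)) ->
  (forall s : R, 0 <= s -> is_derive s 1 psi (chi s)) ->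
  (forall s : R, 0 <= s -> {for s, continuous chi}) ->
  C2_jet (fun x => phi (sqdist c x))
    (fun x => (2 * psi (sqdist c x)) *: (x - c))
    (fun x => (4 * chi (sqdist c x)) *: ((x - c)^T *m (x - c))
              + (2 * psi (sqdist c x))%:M).
Proof.
move=> dphi dpsi cchi.
have cphi x : {for x, continuous (fun x => phi (sqdist c x))}.
  apply: continuous_comp; first exact: continuous_sqdist.
  exact: is_derive_continuous (dphi _ (sqdist_ge0 c x)).
have cpsi x : {for x, continuous (fun x => psi (sqdist c x))}.
  apply: continuous_comp; first exact: continuous_sqdist.
  exact: is_derive_continuous (dpsi _ (sqdist_ge0 c x)).
have cchi' x : {for x, continuous (fun x => chi (sqdist c x))}.
  apply: continuous_comp; first exact: continuous_sqdist.
  exact: cchi _ (sqdist_ge0 c x).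
have cc (b : R) x : {for x, continuous (fun _ : V => b)} by exact: cst_continuous.
split=> [x i|x i j|x|i|i j].
- rewrite mxE.
  apply: (is_derive_eq (is_derive_comp_real (is_derive_sqdist c x i) (dphi _ (sqdist_ge0 c x)))).
  by rewrite mulrA (mulrC _ 2).
- have -> : (fun y => ((2 * psi (sqdist c y)) *: (y - c)) ord0 i) =
      (2 \*: ((fun y => psi (sqdist c y)) * (fun y : V => (y - c) ord0 i))).
    by apply/funext => y; rewrite mxE -mulrA.
  have d1 := is_derive_comp_real (is_derive_sqdist c x j) (dpsi _ (sqdist_ge0 c x)).
  apply: (is_derive_eq (is_deriveZ 2 (is_deriveM d1 (is_derive_coord x (evec R j) c i)))).
  rewrite [evec R j]/(delta_mx _ _) [delta_mx _ _ _ _]mxE eqxx /=.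
  rewrite [RHS]mxE [X in _ = X + _]mxE [X in _ = _ * X + _]mxE big_ord1.
  rewrite [X in _ = _ * (X * _) + _]mxE [X in _ = _ + X]mxE.
  by rewrite /GRing.scale /= -mulr_natr; ring.
- exact: cphi.
- under eq_fun do rewrite mxE.
  move=> x; have ci := @continuous_coordB c i x.
  have c2 : {for x, continuous (fun y => 2 * psi (sqdist c y))} := continuousM (cc _ x) (cpsi x).
  exact: (continuousM c2 ci).
- under eq_fun do rewrite mxE [X in X + _]mxE [X in _ * X + _]mxE big_ord1
    [X in _ * (X * _) + _]mxE [X in _ + X]mxE.
  move=> x; have ci := @continuous_coordB c i x; have cj := @continuous_coordB c j x.
  have c4 : {for x, continuous (fun y => 4 * chi (sqdist c y))} := continuousM (cc _ x) (cchi' x).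
  have c2 : {for x, continuous (fun y => 2 * psi (sqdist c y))} := continuousM (cc _ x) (cpsi x).
  have c0 : {for x, continuous (fun y => (2 * psi (sqdist c y)) *+ (i == j))}.
    by case: (i == j); [exact: c2|exact: cc].
  exact: (continuousD (continuousM c4 (continuousM ci cj)) c0).
Qed.

End Jets.

Lemma continuous_cmul (R : realType) (f : R -> R) (x c : R) :
  {for x, continuous f} -> {for x, continuous (fun y => c * f y)}.
Proof. by move=> cf; apply: cvgM; [exact: cvg_cst|exact: cf]. Qed.

(** * The operator evaluated on a fixed frame, and its barriers *)

Section FrameOperator.
Variables (R : realType) (n : nat).
Notation V := 'rV[R]_n.
Implicit Types (us : seq V) (p y : V) (A : 'M[R]_n).

(** Trace and Bessel conditions replace orthonormality: equivalently, the sum of the [u^T u] has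
    trace [k] and is at most the identity. The length of [us] is free. *)
Definition kframe (k : nat) us : Prop :=
  \sum_(u <- us) (u *m u^T) ord0 ord0 = k%:R /\
  forall x : V, \sum_(u <- us) ((u *m x^T) ord0 ord0) ^+ 2 <= (x *m x^T) ord0 ord0.

Definition frame_op (h : R) us p A : R :=
  \sum_(u <- us) (u *m A *m u^T) ord0 ord0 - h * enorm p.

Lemma frame_op0 h us : frame_op h us 0 0 = 0.
Proof.
rewrite /frame_op enorm0 mulr0 subr0 big1 // => u _.
by rewrite mulmx0 mul0mx mxE.
Qed.

(** The second order part is additive for a fixed frame, and the triangle inequality gives the
    gradient term the favourable sign. *)
Lemma frame_opD h us p1 p2 A1 A2 : 0 <= h ->
  frame_op h us p1 A1 + frame_op h us p2 A2 <= frame_op h us (p1 + p2) (A1 + A2).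
Proof.
move=> h0; rewrite /frame_op.
have -> : \sum_(u <- us) (u *m (A1 + A2) *m u^T) ord0 ord0 =
  \sum_(u <- us) (u *m A1 *m u^T) ord0 ord0 + \sum_(u <- us) (u *m A2 *m u^T) ord0 ord0.
  by rewrite -big_split /=; apply: eq_bigr => u _; rewrite mulmxDr mulmxDl mxE.
have : h * enorm (p1 + p2) <= h * (enorm p1 + enorm p2) by rewrite ler_wpM2l ?enormD.
by rewrite mulrDr; lra.
Qed.

Lemma Fk_frame h k O f x : open O -> C2_on O f -> O x -> (k <= n)%N ->
  exists us, kframe k us /\
    Fk h k f x = frame_op h us (\row_i pd i f x) (hessian f x).
Proof.
move=> oO fC Ox kn.
have [us [us1 us2 usE]] := Pkminus_frame (hessian_sym oO fC Ox) kn.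
exists us; split=> //; rewrite /Fk /frame_op usE; congr (_ - _ * Num.sqrt _).
by apply: eq_bigr => i _; rewrite mxE.
Qed.

(** The value is affine in [q], the sum of the squared products of the frame with [y], and
    [0 <= q <= |y|^2] by Bessel. It therefore suffices to have the bound at the two endpoints, which
    are the hypotheses on [L]. *)
Lemma frame_op_radial (h psi chi L : R) k us y : kframe k us -> 0 <= psi ->
  L <= k%:R * psi - h * enorm y * psi ->
  L <= k%:R * psi + 2 * chi * enorm y ^+ 2 - h * enorm y * psi ->
  2 * L <= frame_op h us ((2 * psi) *: y) ((4 * chi) *: (y^T *m y) + (2 * psi)%:M).
Proof.
move=> [us1 us2] psi0 L1 L2; rewrite /frame_op enormZ ger0_norm ?mulr_ge0 //.
set q := \sum_(u <- us) ((u *m y^T) ord0 ord0) ^+ 2.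
have q0 : 0 <= q by apply: sumr_ge0 => u _; exact: sqr_ge0.
have q1 : q <= enorm y ^+ 2 by rewrite -enorm_mulmx; exact: us2.
have -> : \sum_(u <- us) (u *m ((4 * chi) *: (y^T *m y) + (2 * psi)%:M) *m u^T) ord0 ord0
  = 4 * chi * q + 2 * psi * k%:R.
  rewrite -us1 !mulr_sumr -big_split /=; apply: eq_bigr => u _.
  rewrite mulmxDr mulmxDl mul_mx_scalar -scalemxAr -!scalemxAl mxE.
  rewrite [X in X + _]mxE [X in _ + X]mxE; congr (_ * _ + _).
  have -> : u *m (y^T *m y) *m u^T = (u *m y^T) *m (y *m u^T) by rewrite !mulmxA.
  rewrite mxE big_ord1 expr2; congr (_ * _).
  by rewrite !mulmx_trE; apply: eq_bigr => i _; rewrite mulrC.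
have [c0|c0] := leP 0 chi.
  have : 0 <= chi * q by rewrite mulr_ge0.
  by lra.
have : chi * enorm y ^+ 2 <= chi * q by rewrite ler_nM2l.
by lra.
Qed.

Lemma sqdist_enorm (c x : V) : sqdist c x = enorm (x - c) ^+ 2.
Proof. by rewrite sqr_enorm. Qed.

Lemma radial_barrier (k : nat) (a h Rd r : R) (c : V) :
  (0 < k)%N -> 0 <= h -> h * Rd = a -> 0 <= a -> a < k%:R ->
  0 < r -> r <= Rd / 2 ->
  exists (w : V -> R) (g : V -> V) (H : V -> 'M[R]_n),
  [/\ C2_jet w g H,
     forall x, enorm (x - c) <= Rd ->
       - (16 / (k%:R - a) * expR (2 * a) * Psi k Rd r) <= w x <= 0 &
     forall x us, enorm (x - c) <= Rd -> kframe k us ->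
       0 <= frame_op h us (g x) (H x) /\
       (enorm (x - c) < r -> 1 <= frame_op h us (g x) (H x))].
Proof.
move=> k0 h0 hRd a0 ak r0 rRd; have [phi [dphi bphi]] := profile_potential r0 rRd k0 h0.
set m := minn k 3 in dphi.
have mk : (m <= k)%N by rewrite geq_minl.
have m4 : (m <= 4)%N by rewrite (leq_trans (geq_minr _ _)).
have ka0 : 0 < k%:R - a by rewrite subr_gt0.
(* Chosen so that [2 * B] times the lower bound [(k - a) / 8] of [profile_core] equals 1; multiplied
   by the 4 of [profile_potential] it yields the 16. *)
pose B := 4 / (k%:R - a); have B0 : 0 < B by rewrite divr_gt0.
pose psi s := B * profile_d m r h s; pose chi s := B * profile_dd m r h s.
have cchi (s : R) : 0 <= s -> {for s, continuous chi}.
  by move=> s0; apply: continuous_cmul; exact: continuous_profile_dd.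
exists (fun x => B * phi (sqdist c x)), (fun x => (2 * psi (sqdist c x)) *: (x - c)),
  (fun x => (4 * chi (sqdist c x)) *: ((x - c)^T *m (x - c)) + (2 * psi (sqdist c x))%:M).
have xs x : enorm (x - c) <= Rd -> 0 <= sqdist c x <= Rd ^+ 2.
  move=> xR; rewrite sqdist_ge0 sqdist_enorm ler_pXn2r ?nnegrE ?enorm_ge0 //.
  exact: le_trans (enorm_ge0 _) xR.
split.
- apply: (@jet_radial _ _ (fun s => B * phi s) psi chi) => s s0.
  + exact: is_derive_cmul (dphi s s0).
  + exact: is_derive_cmul (is_derive_profile_d r0 m h s0).
  + exact: cchi.
- move=> x /xs/bphi/andP[p1 p2]; rewrite (pmulr_rle0 _ B0) p2 andbT.
  have -> : - (16 / (k%:R - a) * expR (2 * a) * Psi k Rd r) =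
    B * - (4 * expR (2 * (h * Rd)) * Psi k Rd r) by rewrite /B hRd; field; rewrite gt_eqF.
  by rewrite ler_pM2l.
- move=> x us xR usk.
  have s0 := sqdist_ge0 c x.
  have sq : Num.sqrt (sqdist c x) = enorm (x - c) by [].
  have T1 := profile_tangential r0 m h0 hRd ak s0 xR.
  have T2 := profile_radial r0 mk h0 hRd a0 s0 xR.
  rewrite sq in T1 T2.
  set z := (r * (tau r (sqdist c x))^-1) ^+ 2 in T1 T2.
  set P := profile_d m r h (sqdist c x) in T1 T2.
  have P0 : 0 <= P by exact: profile_d_ge0.
  have op : 2 * (B * (P * ((k%:R - a) * z))) <=
     frame_op h us ((2 * psi (sqdist c x)) *: (x - c))
     ((4 * chi (sqdist c x)) *: ((x - c)^T *m (x - c)) + (2 * psi (sqdist c x))%:M).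
    apply: (frame_op_radial usk); first by rewrite mulr_ge0 // ltW.
      apply: le_trans (_ : B * (k%:R * P - h * enorm (x - c) * P) <= _).
        by rewrite ler_pM2l.
      by rewrite /psi -/P le_eqVlt; apply/orP; left; apply/eqP; ring.
    apply: le_trans (_ : B * (k%:R * P + 2 * profile_dd m r h (sqdist c x) * sqdist c x
        - h * enorm (x - c) * P) <= _).
      by rewrite ler_pM2l.
    by rewrite /psi /chi -/P -sqdist_enorm le_eqVlt; apply/orP; left; apply/eqP; ring.
  split.
    have z0 : 0 <= z by rewrite /z sqr_ge0.
    have A1 := mulr_ge0 (ltW ka0) z0; have A2 := mulr_ge0 P0 A1.
    have A3 := mulr_ge0 (ltW B0) A2.
    by apply: le_trans op; rewrite mulr_ge0.
  move=> xr; apply: le_trans op.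
  have sr : sqdist c x < r ^+ 2.
    by rewrite sqdist_enorm ltr_pXn2r ?nnegrE ?enorm_ge0 // ltW.
  have C := profile_core r0 h0 ak s0 m4 sr.
  rewrite -/P -/z in C.
  have : B * ((k%:R - a) / 8) <= B * (P * ((k%:R - a) * z)) by rewrite ler_pM2l.
  have -> : B * ((k%:R - a) / 8) = 2^-1 by rewrite /B; field; rewrite gt_eqF.
  by lra.
Qed.

(** Induction on the list of balls: one ball containing the point already contributes 1, the others
    contribute at least 0. The summands are only known to be nonpositive, so the constant [- Q]
    provides strict negativity. *)
Lemma cover_barrier (k : nat) (a h Rd Q : R) (bs : seq (V * R)) (D : set V) :
  (0 < k)%N -> 0 <= h -> h * Rd = a -> 0 <= a -> a < k%:R ->
  (forall b, b \in bs -> 0 < b.2 <= Rd / 2) ->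
  (forall b x, b \in bs -> D x -> enorm (x - b.1) <= Rd) ->
  exists (w : V -> R) (g : V -> V) (H : V -> 'M[R]_n),
  [/\ C2_jet w g H,
     forall x, D x ->
       - (16 / (k%:R - a) * expR (2 * a) * (\sum_(b <- bs) Psi k Rd b.2) + Q)
         <= w x <= - Q &
     forall x us, D x -> kframe k us ->
       0 <= frame_op h us (g x) (H x) /\
       ((exists2 b, b \in bs & enorm (x - b.1) < b.2) ->
         1 <= frame_op h us (g x) (H x))].
Proof.
move=> k0 h0 hRd a0 ak; elim: bs => [|b bs IH] br bD.
  exists (fun=> - Q), (fun=> 0), (fun=> 0); split; first exact: jet_cst.
    by move=> x _; rewrite big_nil mulr0 add0r lexx.
  move=> x us _ _; rewrite frame_op0; split=> //.
  by case=> b; rewrite in_nil.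
have [||w [g [H [wj wb wop]]]] := IH.
- by move=> b' b'bs; apply: br; rewrite inE b'bs orbT.
- by move=> b' x b'bs; apply: bD; rewrite inE b'bs orbT.
have /andP[r0 rRd] := br b (mem_head _ _).
have [w' [g' [H' [wj' wb' wop']]]] := radial_barrier b.1 k0 h0 hRd a0 ak r0 rRd.
exists (fun x => w' x + w x), (fun x => g' x + g x), (fun x => H' x + H x); split.
- exact: jetD.
- move=> x Dx; have xb := bD b x (mem_head _ _) Dx.
  have /andP[A1 A2] := wb x Dx; have /andP[B1 B2] := wb' x xb.
  by rewrite big_cons mulrDr; apply/andP; split; lra.
- move=> x us Dx usk; have xb := bD b x (mem_head _ _) Dx.
  have [A1 A2] := wop x us Dx usk; have [B1 B2] := wop' x us xb usk.
  have S := @frame_opD h us (g' x) (g x) (H' x) (H x) h0.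
  split; first by lra.
  case=> b'; rewrite inE => /orP[/eqP->|b'bs] xb'; first by have := B2 xb'; lra.
  have A3 : 1 <= frame_op h us (g x) (H x) by apply: A2; exists b'.
  by lra.
Qed.

End FrameOperator.

(** * Covers *)

Section Geometry.
Variables (R : realType) (n : nat).
Notation V := 'rV[R]_n.
Implicit Types (A E Om : set V) (x y c : V).

(** Around each point of [E] half the radius of a ball inside [Om] is a valid margin; compactness in
    its near-covering form makes it uniform. The distance here is the sup norm. *)
Lemma compact_margin E Om : compact E -> open Om -> E `<=` Om ->
  exists2 d : R, 0 < d & forall e y, E e -> `|y - e| < d -> Om y.
Proof.
move=> /compact_near_coveringP cE oO EO.
have : \forall d \near 0^'+, E `<=` [set e | forall y, `|y - e| < d -> Om y].
  apply: (cE R (0^'+) (fun d e => forall y, `|y - e| < d -> Om y)) => x Ex.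
  have /nearE_norm[r r0 rO] : \forall y \near x, Om y.
    exact: open_nbhs_nbhs (conj oO (EO _ Ex)).
  have r20 : 0 < r / 2 by rewrite divr_gt0.
  have nx : \forall x' \near x, `|x' - x| < r / 2 by apply/nearE_norm; exists (r / 2).
  exists ([set x' | `|x' - x| < r / 2], [set d | d < r / 2]).
    by split; [exact: nx|exact: nbhs_right_lt].
  move=> [x' d] /= [x'x dr] y yx'; apply: rO.
  rewrite -(subrK x' y) -addrA; apply: le_lt_trans (ler_normD _ _) _; lra.
move=> dE.
near (0 : R)^'+ => d; exists d; first by near: d; exact: nbhs_right_gt.
by move=> e y Ee; have := near dE d; apply.
Unshelve. all: by end_near. Qed.

Lemma closure_norm A x : closure A x ->
  forall e : R, 0 < e -> exists2 y, A y & `|y - x| < e.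
Proof.
move=> Ax e e0.
have nx : \forall y \near x, `|y - x| < e by apply/nearE_norm; exists e.
by have [y [Ay yx]] := Ax _ nx; exists y.
Qed.

Lemma continuous_enormB c : continuous (fun y => enorm (y - c)).
Proof.
move=> y; apply: (@continuous_comp _ _ _ (sqdist c) Num.sqrt).
  exact: continuous_sqdist.
exact: sqrt_continuous.
Qed.

Lemma open_eball c (r : R) : open (eball c r).
Proof.
have -> : eball c r = (fun y => enorm (y - c)) @^-1` [set t | t < r] by [].
apply: open_comp; last exact: open_lt.
by move=> y _; exact: continuous_enormB.
Qed.

Lemma diam_ge Om (Rd : R) x y : diam Om = Rd%:E -> Om x -> Om y -> enorm (x - y) <= Rd.
Proof.
move=> dO Ox Oy; rewrite -lee_fin -dO; apply: ereal_sup_ubound.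
by exists x, y.
Qed.

(** A violation is an open condition on the first point, so it would spread from the closure to a
    point of [Om]. *)
Lemma diam_closure_ge Om (Rd : R) x y :
  diam Om = Rd%:E -> closure Om x -> Om y -> enorm (x - y) <= Rd.
Proof.
move=> dO Ox Oy; rewrite leNgt; apply/negP => xy.
have oG : open [set z | Rd < enorm (z - y)].
  have -> : [set z | Rd < enorm (z - y)] = (fun z => enorm (z - y)) @^-1` [set t | Rd < t] by [].
  apply: open_comp; last exact: open_gt.
  by move=> z _; exact: continuous_enormB.
have [z [Oz]] := Ox _ (open_nbhs_nbhs (conj oG xy)).
by rewrite /= ltNge (diam_ge dO).
Qed.

Lemma diam_fin_nonempty Om (Rd : R) : diam Om = Rd%:E -> exists x, Om x.
Proof.
move=> dO; apply/not_existsP => O0; move: dO; rewrite /diam.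
have -> : [set z | exists x y, Om x /\ Om y /\ z = (enorm (x - y))%:E] = set0.
  by apply/seteqP; split=> // z [x [y [Ox]]]; have := O0 x.
by rewrite ereal_sup0.
Qed.

Lemma diam_gt0 Om (Rd : R) : (0 < n)%N -> open Om -> diam Om = Rd%:E -> 0 < Rd.
Proof.
move=> n0 oO dO; have [x Ox] := diam_fin_nonempty dO.
have /nearE_norm[r r0 rO] : \forall y \near x, Om y.
  exact: open_nbhs_nbhs (conj oO Ox).
pose v := evec R (Ordinal n0); pose t := r / 2 / (`|v| + 1).
have v0 : 0 < `|v| + 1 by rewrite ltr_wpDl.
have t0 : 0 < t by rewrite !divr_gt0.
have Oy : Om (x + t *: v).
  apply: rO; rewrite addrAC subrr add0r normrZ gtr0_norm //.
  apply: le_lt_trans (_ : t * (`|v| + 1) < _); first by rewrite ler_wpM2l ?lerDl // ltW.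
  by rewrite /t divfK ?gt_eqF //; lra.
apply: lt_le_trans (diam_ge dO Oy Ox).
rewrite addrAC subrr add0r enormZ mulr_gt0 ?normr_gt0 ?gt_eqF //.
apply: lt_le_trans (coord_le_enorm v (Ordinal n0)).
by rewrite /v /evec mxE !eqxx normr1.
Qed.

Lemma Psi_ge0 (k : nat) (Rd t : R) : 0 <= Rd -> 0 <= t -> 0 <= Psi k Rd t.
Proof.
move=> R0 t0; rewrite /Psi; case: ifP => _; first exact: mulr_ge0.
by case: ifP => _; rewrite ?mulr_ge0 // sqr_ge0.
Qed.

(** A smaller [d] admits fewer covers, so the limit at [0^'+] is a supremum over [d > 0]. *)
Lemma Hdelta_le_HPsi (Ps : R -> R) E (d : R) : 0 < d ->
  (Hdelta Ps E d <= HPsi Ps E)%E.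
Proof.
move=> d0.
have mono : {in Interval (BRight 0) +oo%O &, nonincreasing_fun (Hdelta Ps E)}.
  move=> d1 d2 _ _ d12; apply: ereal_inf_le_tmp => S [c [r [rd Ec SE]]].
  exists c, r; split=> // j; have /andP[r0 r1] := rd j.
  by rewrite r0 (le_trans r1).
have cv := @nonincreasing_at_right_cvge R (Hdelta Ps E) 0 +oo%O isT mono.
rewrite /HPsi (cvg_lim _ cv) //; apply: ereal_sup_ubound.
by exists d => //=; rewrite in_itv /= d0.
Qed.

Lemma HPsi_ge0 (Ps : R -> R) E : (forall t, 0 <= t -> 0 <= Ps t) -> (0 <= HPsi Ps E)%E.
Proof.
move=> Ps0; apply: le_trans (Hdelta_le_HPsi Ps E ltr01).
apply: le_ereal_inf_tmp => S [c [r [rd Ec ->]]].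
by apply: nneseries_ge0 => j _ _; rewrite lee_fin Ps0 //; have /andP[] := rd j.
Qed.

Lemma sum_seq_le_nneseries (u : nat -> R) (s : seq nat) : (forall j, 0 <= u j) ->
  uniq s -> ((\sum_(j <- s) u j)%:E <= \sum_(0 <= j <oo) (u j)%:E)%E.
Proof.
move=> u0 us; pose N := (\max_(j <- s) j).+1.
apply: le_trans (nneseries_lim_ge N _); last by move=> j _ _; rewrite lee_fin.
rewrite sumEFin lee_fin.
have sE : perm_eq s [seq j <- index_iota 0 N | j \in s].
  apply: uniq_perm => // [|j]; first by rewrite filter_uniq // iota_uniq.
  rewrite mem_filter mem_index_iota /=; case: (boolP (j \in s)) => //= js.
  by rewrite /N ltnS (@leq_bigmax_seq nat s xpredT id j).
rewrite (perm_big _ sE) big_filter /= big_mkcond /=.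
by apply: ler_sum => j _; case: ifP.
Qed.

Lemma HPsi_finite_cover (Ps : R -> R) E (Q d : R) : compact E ->
  (forall t, 0 <= t -> 0 <= Ps t) -> (HPsi Ps E < Q%:E)%E -> 0 < d ->
  exists bs : seq (V * R),
  [/\ forall b, b \in bs -> 0 < b.2 <= d,
      forall b, b \in bs -> exists2 e, E e & enorm (e - b.1) < b.2,
      forall e, E e -> exists2 b, b \in bs & enorm (e - b.1) < b.2 &
      \sum_(b <- bs) Ps b.2 <= Q].
Proof.
move=> cE Ps0 HQ d0.
have [S [c [r [rd Ec ->]]] SQ] := ereal_inf_lt (le_lt_trans (Hdelta_le_HPsi Ps E d0) HQ).
(* Keeping only the balls that meet [E] discards those of radius 0, which are empty, and keeps every
   centre within [d] of [E]. *)
pose J := [set j : nat | exists2 e, E e & enorm (e - c j) < r j].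
rewrite compact_cover in cE.
have [||s sJ Es] := cE nat J (fun j => eball (c j) (r j)).
- by move=> j _; exact: open_eball.
- move=> e Ee; have [j _ ej] := Ec _ Ee.
  by exists j => //; exists e.
exists [seq (c j, r j) | j <- finmap.enum_fset s]; split.
- move=> b /mapP[j js ->] /=; have [e Ee ej] := set_mem (sJ _ js).
  by have /andP[_ ->] := rd j; rewrite (le_lt_trans (enorm_ge0 _) ej).
- by move=> b /mapP[j js ->] /=; exact: set_mem (sJ _ js).
- move=> e Ee; have [j js ej] := Es _ Ee.
  by exists (c j, r j) => //; apply/mapP; exists j.
- rewrite big_map /= -lee_fin; apply: le_trans (ltW SQ).
  apply: (@sum_seq_le_nneseries (fun j => Ps (r j))); last exact: finmap.fset_uniq.
  by move=> j; apply: Ps0; have /andP[] := rd j.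
Qed.

End Geometry.

(** * The global barrier and its consequences for [mubar] *)

Section MainEstimates.
Variables (R : realType) (n : nat).
Notation V := 'rV[R]_n.

Lemma barrier_exists (k : nat) (a h Rd Q : R) (Om E : set V) :
  (0 < k)%N -> (k <= n)%N -> 0 <= h -> h * Rd = a -> 0 <= a -> a < k%:R ->
  open Om -> diam Om = Rd%:E -> compact E -> E `<=` Om ->
  (HPsi (Psi k Rd) E < Q%:E)%E ->
  exists (U : set V) (w : V -> R) (g : V -> V) (H : V -> 'M[R]_n),
  [/\ [/\ open U, E `<=` U, compact (closure U) & closure U `<=` Om],
      C2_jet w g H,
      forall x, closure Om x ->
        - ((16 / (k%:R - a) * expR (2 * a) + 1) * Q) <= w x <= - Q &
      forall x us, Om x -> kframe k us -> \1_U x <= frame_op h us (g x) (H x)].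
Proof.
move=> k0 kn h0 hRd a0 ak oO dO cE EO HQ.
have Rd0 : 0 < Rd by apply: diam_gt0 oO dO; rewrite (leq_trans k0).
have Ps0 t : 0 <= t -> 0 <= Psi k Rd t by apply: Psi_ge0; exact: ltW.
have Q0 : 0 < Q by rewrite -lte_fin (le_lt_trans _ HQ) // HPsi_ge0.
have [d d0 dOm] := compact_margin cE oO EO.
(* A point of [closure U] reaches [E] in three steps, each shorter than [d / 3]: to a point of [U],
   to the centre of its ball, to a point of [E]. The bound [Rd / 2] is the one required by the
   radial barriers. *)
pose d' := Num.min (d / 3) (Rd / 2).
have d'0 : 0 < d' by rewrite lt_min !divr_gt0.
have d'd : d' <= d / 3 by rewrite ge_min lexx.
have d'R : d' <= Rd / 2 by rewrite ge_min lexx orbT.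
have [bs [b0 bE Eb bsum]] := HPsi_finite_cover cE Ps0 HQ d'0.
have cOm b : b \in bs -> Om b.1.
  move=> bbs; have [e Ee eb] := bE _ bbs; apply: (dOm e) => //.
  have /andP[_ bd] := b0 _ bbs.
  by rewrite distrC; apply: le_lt_trans (norm_le_enorm _) _; lra.
have br b : b \in bs -> 0 < b.2 <= Rd / 2.
  by move=> /b0/andP[-> /le_trans]; apply.
have bD b x : b \in bs -> closure Om x -> enorm (x - b.1) <= Rd.
  by move=> /cOm bO xO; exact: diam_closure_ge dO xO bO.
have [w [g [H [wj wb wop]]]] := cover_barrier Q k0 h0 hRd a0 ak br bD.
pose U := \bigcup_(b in [set` bs]) eball b.1 b.2.
have UE x : U x <-> exists2 b, b \in bs & enorm (x - b.1) < b.2.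
  by split=> [[b bbs xb]|[b bbs xb]]; exists b.
have clU : closure U `<=` Om.
  move=> x Ux; have [y Uy yx] := closure_norm Ux (divr_gt0 d0 (ltr0Sn _ 2)).
  have [b bbs yb] := (UE y).1 Uy; have [e Ee eb] := bE _ bbs.
  have /andP[_ bd] := b0 _ bbs; apply: (dOm e) => //.
  have -> : x - e = - (y - x) + ((y - b.1) - (e - b.1)).
    by rewrite !opprB !subrKA.
  apply: le_lt_trans (ler_normD _ _) _; rewrite normrN.
  have := ler_normB (y - b.1) (e - b.1).
  have := norm_le_enorm (y - b.1); have := norm_le_enorm (e - b.1).
  lra.
exists U, w, g, H; split=> //.
- split=> //.
  + by apply: bigcup_open => b _; exact: open_eball.
  + apply: bounded_closed_compact; last exact: closed_closure.
    have [y0 Oy0] := diam_fin_nonempty dO.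
    exists (`|y0| + Rd); split; first exact: num_real.
    move=> M yM x /clU Ox.
    apply: le_trans (ltW yM); rewrite -(subrK y0 x) addrC.
    apply: le_trans (ler_normD _ _) _; rewrite lerD2l.
    exact: le_trans (norm_le_enorm (x - y0)) (diam_ge dO Ox Oy0).
- move=> x xO; have /andP[w1 ->] := wb x xO; rewrite andbT.
  have c0 : 0 <= 16 / (k%:R - a) * expR (2 * a).
    by rewrite mulr_ge0 ?expR_ge0 // divr_ge0 // subr_ge0 ltW.
  by have := ler_wpM2l c0 bsum; lra.
- move=> x us Ox usk; have [A B] := wop x us (subset_closure Ox) usk.
  by rewrite indicE; case: (boolP (x \in U)) => // xU; exact: (B ((UE x).1 (set_mem xU))).
Qed.

Lemma jet_grad (w : V -> R) g H x : C2_jet w g H -> \row_i pd i w x = g x.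
Proof. by move=> wj; apply/rowP => i; rewrite mxE (jet_pd i wj). Qed.

(** The frame is taken from the Hessian of [phi]. The lower bound for [w] holds on every frame,
    hence on this one, and passes to [phi] because the gradients agree and the quadratic forms are
    ordered. The term [C^-1 * w] costs at most 1. *)
Lemma jet_visc_super (w : V -> R) g H (h C : R) (k : nat) (U : set V) :
  (k <= n)%N -> C2_jet w g H ->
  (forall x us, U x -> kframe k us -> 1 <= frame_op h us (g x) (H x)) ->
  (forall x, U x -> - C <= w x) -> 0 < C -> visc_super h k C^-1 U w.
Proof.
move=> kn wj wop wC C0 x0 Ux0 phi [N [oN Nx phiC]] mx.
have [gE HE] := local_max_order2 oN (jet_C2_on (O := N) wj) phiC Nx mx.
have [us [usk ->]] := Fk_frame h oN phiC Nx kn.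
have A := wop x0 us Ux0 usk.
have B : frame_op h us (g x0) (H x0) <=
    frame_op h us (\row_i pd i phi x0) (hessian phi x0).
  have -> : \row_i pd i phi x0 = g x0.
    by rewrite -(jet_grad x0 wj); apply/rowP => i; rewrite !mxE gE.
  rewrite /frame_op lerD2r -(jet_hessian x0 wj).
  by apply: ler_sum => u _; exact: HE.
have D : -1 <= C^-1 * w x0.
  by rewrite -(mulVf (lt0r_neq0 C0)) -mulrN ler_pM2l ?invr_gt0 // wC.
lra.
Qed.

Lemma mubar_ge (w : V -> R) (h c : R) (k : nat) (E U : set V) :
  open U -> E `<=` U -> continuous w -> (forall x, closure U x -> w x < 0) ->
  visc_super h k c U w -> (c%:E <= mubar h k E)%E.
Proof.
move=> oU EU cw w0 wv; apply: le_ereal_sup_tmp; exists (mubar_open h k U).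
  by exists U.
apply: ereal_sup_ubound; exists c => //; exists w; split=> //.
move=> x _ e e0; have [d d0 dP] := continuous_dist (cw x) e0.
apply/nearE_norm; exists d => // y /dP; rewrite ltr_norml => /andP[_ ye] _.
lra.
Qed.

(** Passage to the limit as [Q] decreases to [Hs], in the variable [t = (C Q)^-1]: every positive
    [t] below [(C Hs)^-1] is a lower bound of [m], and every positive [t] is one when [Hs = 0]. *)
Lemma mubar_lower_bound (C : R) (Hs m : \bar R) : 0 < C -> (0 <= Hs)%E -> (Hs < +oo)%E ->
  (forall Q : R, (Hs < Q%:E)%E -> ((C * Q)^-1%:E <= m)%E) ->
  ((if Hs == 0%:E then +oo else ((C * fine Hs)^-1)%:E) <= m)%E.
Proof.
move=> C0; case: Hs => // Hs; rewrite lee_fin => H0 _ bd.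
have bd' t : 0 < t -> Hs < (C * t)^-1 -> (t%:E <= m)%E.
  move=> t0 Ht; have := bd (C * t)^-1; rewrite lte_fin => /(_ Ht).
  suff -> : (C * (C * t)^-1)^-1 = t by [].
  by field; rewrite !gt_eqF.
case: ifPn => [/eqP[Hs0]|].
  suff -> : m = +oo%E by [].
  apply: eq_infty => t; apply: (@le_trans _ _ (Num.max t 1)%:E).
    by rewrite lee_fin le_max lexx.
  have m0 : 0 < Num.max t 1 by rewrite lt_max ltr01 orbT.
  by apply: bd' => //; rewrite Hs0 invr_gt0 mulr_gt0.
rewrite eqe => Hs0; have {Hs0}H0 : 0 < Hs by rewrite lt_def Hs0.
rewrite /=; set v := (C * Hs)^-1.
have v0 : 0 < v by rewrite invr_gt0 mulr_gt0.
have bdv t : 0 < t -> t < v -> (t%:E <= m)%E.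
  move=> t0 tv; apply: bd' => //.
  move: tv; rewrite /v -[(C * Hs)^-1]div1r -[(C * t)^-1]div1r !ltr_pdivlMr ?mulr_gt0 //.
  by have -> : Hs * (C * t) = t * (C * Hs) by ring.
rewrite leNgt; apply/negP => mv.
(* This excludes [m = -oo] and makes a finite [m] positive; the midpoint of [m] and [v] then gives
   the contradiction. *)
have : ((v / 2)%:E <= m)%E by apply: bdv; lra.
case: m mv bd bd' bdv => // m; rewrite lte_fin => mv _ _ bdv; rewrite lee_fin => vm.
have : (((m + v) / 2)%:E <= m%:E)%E by apply: bdv; lra.
by rewrite lee_fin; lra.
Qed.

End MainEstimates.

Unset Implicit Arguments. Set Strict Implicit. Set Printing Implicit Defensive.

(** Fixing [a] before [C1] and imposing [h * Rd = a] afterwards expresses that the constant depends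
    on [h] and the diameter only through their product. The conditional encodes the convention for
    [1 / 0]. *)
Theorem mainTheorem6 (R : realType) (n k : nat) (a : R) :
  (3 <= n)%N -> (1 <= k < n)%N -> 0 <= a -> a < k%:R ->
  exists C1 : R, 0 < C1 /\
  forall (Om E : set 'rV[R]_n) (Rd h : R),
    open Om -> diam Om = Rd%:E ->
    compact E -> E `<=` Om ->
    (HPsi (Psi k Rd) E < +oo)%E ->
    0 <= h -> h * Rd = a ->
    (forall Q : R, (HPsi (Psi k Rd) E < Q%:E)%E ->
      exists (U : set 'rV[R]_n) (w : 'rV[R]_n -> R),
        [/\ open U, E `<=` U, compact (closure U) & closure U `<=` Om] /\
        C2_closure Om w /\
        [/\ forall x, closure Om x -> w x < 0,
            forall x, Om x -> \1_U x <= Fk h k w x,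
            forall x, closure Om x -> `|w x| <= C1 * Q,
            forall x, U x -> 0 <= Fk h k w x + (C1 * Q)^-1 * w x &
            forall x, Om x -> 0 <= Fk h k w x]) /\
    ((if HPsi (Psi k Rd) E == 0%:E then +oo
      else ((C1 * fine (HPsi (Psi k Rd) E))^-1)%:E)
     <= mubar h k E)%E.
Proof.
move=> _ /andP[k0 /ltnW kn] a0 ak.
(* The first term bounds the sum of the radial barriers by a multiple of [Q]; the [+ 1] accounts for
   the constant [- Q]. *)
pose C1 := 16 / (k%:R - a) * expR (2 * a) + 1.
have C10 : 0 < C1.
  by rewrite ltr_wpDl // mulr_ge0 ?expR_ge0 // divr_ge0 // subr_ge0 ltW.
exists C1; split=> // Om E Rd h oO dO cE EO Hfin h0 hRd.
have Rd0 : 0 <= Rd by apply/ltW; apply: diam_gt0 oO dO; rewrite (leq_trans k0).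
have Hs0 : (0 <= HPsi (Psi k Rd) E)%E by apply: HPsi_ge0 => t; exact: Psi_ge0.
have Qpos Q : (HPsi (Psi k Rd) E < Q%:E)%E -> 0 < Q.
  by move=> HQ; rewrite -lte_fin (le_lt_trans Hs0).
split=> [Q HQ|].
  have Q0 := Qpos Q HQ; have CQ : 0 < C1 * Q by rewrite mulr_gt0.
  have [U [w [g [H [UP wj wb wop]]]]] :=
    barrier_exists k0 kn h0 hRd a0 ak oO dO cE EO HQ.
  have [oU EU cU UO] := UP.
  have F x : Om x -> \1_U x <= Fk h k w x.
    move=> Ox; have [us [usk ->]] := Fk_frame h oO (jet_C2_on (O := Om) wj) Ox kn.
    by rewrite (jet_grad x wj) (jet_hessian x wj); exact: wop.
  have i0 x : 0 <= \1_U x :> R by rewrite indicE.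
  exists U, w; split=> //; split; first exact: jet_C2_closure wj.
  split=> [x|//|x|x Ux|x Ox].
  - by move=> /wb/andP[_]; lra.
  - move=> /wb/andP[w1 w2]; rewrite ler_norml; apply/andP; split; first exact: w1.
    by lra.
  - have Ox := UO _ (subset_closure Ux); have := F x Ox.
    rewrite indicE mem_set //= => F1.
    have /andP[w1 _] := wb _ (subset_closure Ox).
    (* From [w >= - C1 Q]; the loss is compensated by the value 1 of the indicator on [U]. *)
    have : -1 <= (C1 * Q)^-1 * w x.
      by rewrite -(mulVf (lt0r_neq0 CQ)) -mulrN ler_pM2l // invr_gt0.
    by lra.
  - exact: le_trans (i0 x) (F x Ox).
apply: mubar_lower_bound => // Q HQ.
have Q0 := Qpos Q HQ; have CQ : 0 < C1 * Q by rewrite mulr_gt0.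
have [U [w [g [H [[oU EU cU UO] wj wb wop]]]]] :=
  barrier_exists k0 kn h0 hRd a0 ak oO dO cE EO HQ.
have UOm x : U x -> Om x by move=> Ux; exact: UO _ (subset_closure Ux).
apply: (mubar_ge oU EU (w := w)).
- by have [] := wj.
- by move=> x /UO/subset_closure/wb/andP[_]; lra.
apply: (jet_visc_super kn wj) => // [x us Ux usk|x Ux].
  by have := wop x us (UOm x Ux) usk; rewrite indicE mem_set.
by have /andP[] := wb _ (subset_closure (UOm x Ux)).
Qed.
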